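(* Let $K$ be a finite simplicial complex. Then the universal cover of $\mathcal{R}_K$ is $W_K$-equivariantly homeomorphic to the basic construction $U(W_K,K(K))$, where $K(K)$ denotes the canonical cubical chamber associated to $K$.
   Context: Let $K$ be a finite simplicial complex on the vertex set $I\subseteq[m]=\{1,\dots,m\}$. With $D^1=[-1,1]$ and $S^0=\{\pm1\}$, the real moment-angle complex of $K$ is the polyhedral product $$\mathcal{R}_K=Z_K(D^1,S^0)=\bigcup_{J\in K}\left(\prod_{i\in J} D^1\times\prod_{j\notin J} S^0\right)\subseteq[-1,1]^m,$$ the union being over all simplices $J$ of $K$; it inherits a cubical structure from the cube $[-1,1]^m$. The right-angled Coxeter group associated to the $1$-skeleton of $K$ is $$W_K=\langle s_i\ (i\in I)\mid s_i^2=1,\ (s_is_j)^2=1\text{ whenever }\{i,j\}\in K\rangle.$$ The chamber is $K(K):=\mathcal{R}_K$, with the mirror structure indexed by $I$ given by the mirrors $M_i:=\{x\in\mathcal{R}_K\mid x_i=0\}$, $i\in I$. The basic construction is $$U(W_K,K(K)):=(W_K\times K(K))/\sim,$$ where $(w,x)\sim(w',x)$ if $w^{-1}w'$ lies in the subgroup of $W_K$ generated by $\{s_i\mid x\in M_i\}$. The group $W_K$ acts on $U(W_K,K(K))$ by left multiplication.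
   Formalization: The chamber K(K) is taken to be the part of R_K with all coordinates nonnegative, with mirrors x_i = 0, not all of R_K: with K(K) = R_K the claim fails already for a single vertex, where U is two intervals crossing at a point while R_K = [-1,1] is its own universal cover. *)

(* Defs.v *)
From HB Require Import structures.
From mathcomp Require Import all_boot all_order all_algebra.
From mathcomp Require Import generic_quotient.
From mathcomp Require Import all_classical all_reals all_analysis.

Set Implicit Arguments.
Unset Strict Implicit.
Unset Printing Implicit Defensive.

Import Order.TTheory GRing.Theory Num.Theory.
Import numFieldNormedType.Exports.

Local Open Scope classical_set_scope.
Local Open Scope ring_scope.
Local Open Scope quotient_scope.

(* The vertex set I of the complex is [vertices K], the set of i such that
   {i} is a simplex. It may be a proper subset of the index set 'I_m. *)
Record scomplex (m : nat) := SComplex {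
  simplices :> {set {set 'I_m}} ;
  simplex0 : (finset.set0 : {set 'I_m}) \in simplices ;
  simplexS : forall A B : {set 'I_m},
    A \subset B -> B \in simplices -> A \in simplices }.

Definition vertices (m : nat) (K : scomplex m) : {set 'I_m} :=
  [set i | [set i]%SET \in K]%SET.

Definition vert (m : nat) (K : scomplex m) : Type :=
  {i : 'I_m | i \in vertices K}.
HB.instance Definition _ m (K : scomplex m) :=
  Finite.copy (vert K) {i : 'I_m | i \in vertices K}.

Section CoxeterGroup.
Context (m : nat) (K : scomplex m).

(* Every generator is an involution, so the presented group is the monoid of
   words in the s_i modulo the congruence generated by the relators. *)
Inductive coxeter_eq : seq (vert K) -> seq (vert K) -> Prop :=
| CoxRefl s : coxeter_eq s s
| CoxSym s t : coxeter_eq s t -> coxeter_eq t s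
| CoxTrans s t u : coxeter_eq s t -> coxeter_eq t u -> coxeter_eq s u
| CoxCat s t u v :
    coxeter_eq s t -> coxeter_eq u v -> coxeter_eq (s ++ u) (t ++ v)
| CoxSquare i : coxeter_eq [:: i; i] [::]
| CoxComm i j : [set val i; val j]%SET \in K ->
    coxeter_eq [:: i; j; i; j] [::].

Definition coxeter_rel (s t : seq (vert K)) : bool := `[< coxeter_eq s t >].

Lemma coxeter_rel_equiv : equiv_class_of coxeter_rel.
Proof.
split=> [s|s t|t s u].
- exact/asboolP/CoxRefl.
- by apply/asboolP/asboolP; exact: CoxSym.
- by move=> /asboolP st /asboolP tu; apply/asboolP/(CoxTrans st tu).
Qed.

Canonical coxeter_equiv := EquivRelPack coxeter_rel_equiv.

Definition coxeter : Type := {eq_quot coxeter_equiv}.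
HB.instance Definition _ := Choice.copy coxeter {eq_quot coxeter_equiv}.
HB.instance Definition _ := Quotient.copy coxeter {eq_quot coxeter_equiv}.

Definition word (s : seq (vert K)) : coxeter := \pi_coxeter s.

Lemma wordP (s t : seq (vert K)) : word s = word t <-> coxeter_eq s t.
Proof.
rewrite /word; split=> [/eqP|st].
  by rewrite piE => /asboolP.
by apply/eqP; rewrite piE; apply/asboolP.
Qed.

Lemma coxeter_eq_repr (s : seq (vert K)) : coxeter_eq (repr (word s)) s.
Proof. by apply/wordP; rewrite /word reprK. Qed.

Definition coxeter_mul (v w : coxeter) : coxeter := word (repr v ++ repr w).
Definition coxeter_inv (w : coxeter) : coxeter := word (rev (repr w)).

Lemma coxeter_mulE s t : coxeter_mul (word s) (word t) = word (s ++ t).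
Proof. by apply/wordP/CoxCat; exact: coxeter_eq_repr. Qed.

Lemma coxeter_ind (P : coxeter -> Prop) :
  (forall s, P (word s)) -> forall w, P w.
Proof. by move=> Ps w; rewrite -[w]reprK; exact: Ps. Qed.

Lemma coxeter_mulA : associative coxeter_mul.
Proof.
elim/coxeter_ind=> s; elim/coxeter_ind=> t; elim/coxeter_ind=> u.
by rewrite !coxeter_mulE catA.
Qed.

Lemma coxeter_mul1 : left_id (word [::]) coxeter_mul.
Proof. by elim/coxeter_ind=> s; rewrite coxeter_mulE. Qed.

Lemma coxeter_1mul : right_id (word [::]) coxeter_mul.
Proof. by elim/coxeter_ind=> s; rewrite coxeter_mulE cats0. Qed.

Lemma coxeter_eq_rev s : coxeter_eq (rev s ++ s) [::].
Proof.
elim: s => [|i s IH]; first exact: CoxRefl.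
rewrite rev_cons -cats1 -catA; apply: CoxTrans IH.
apply: CoxCat; first exact: CoxRefl.
by apply: (@CoxCat [:: i; i] [::] s s); [exact: CoxSquare|exact: CoxRefl].
Qed.

Lemma coxeter_mulVw : left_inverse (word [::]) coxeter_inv coxeter_mul.
Proof.
move=> w; rewrite -[X in coxeter_mul _ X]reprK coxeter_mulE.
exact/wordP/coxeter_eq_rev.
Qed.

Lemma coxeter_mulwV : right_inverse (word [::]) coxeter_inv coxeter_mul.
Proof.
move=> w; rewrite -[X in coxeter_mul X _]reprK coxeter_mulE.
by apply/wordP; rewrite -{1}[repr w]revK; exact: coxeter_eq_rev.
Qed.

HB.instance Definition _ := isGroup.Build coxeter
  coxeter_mulA coxeter_mul1 coxeter_1mul coxeter_mulVw coxeter_mulwV.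

Definition cox_gen (i : vert K) : coxeter := word [:: i].

End CoxeterGroup.

Definition is_subgroup (G : groupType) (H : set G) : Prop :=
  [/\ H 1%g, (forall x y, H x -> H y -> H (x * y)%g)
    & forall x, H x -> H x^-1%g].

Definition generated (G : groupType) (S : set G) : set G :=
  smallest [set H | is_subgroup H] S.

Section RealMomentAngle.
Context (R : realType) (m : nat) (K : scomplex m).

Definition polyhedral_product (X A : set R) : set 'rV[R]_m :=
  \bigcup_(J in [set J : {set 'I_m} | J \in K])
    [set x : 'rV[R]_m | forall i, if i \in J then X (x 0 i) else A (x 0 i)].

Definition real_mac : set 'rV[R]_m := polyhedral_product `[-1, 1] [set 1; -1].

(* The chamber is the part of the real moment-angle complex in [0,1]^m: it is
   this fundamental domain for the coordinate reflections, not the whole of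
   [real_mac], whose W_K-translates glue to the universal cover. *)
Definition chamber : set 'rV[R]_m :=
  [set x | real_mac x /\ forall i, 0 <= x 0 i].

Definition mirror (i : vert K) : set 'rV[R]_m :=
  [set x | chamber x /\ x 0 (val i) = 0].

(* The subgroup generated by the s_i such that x lies in the mirror M_i. *)
Definition local_group (x : 'rV[R]_m) : set (coxeter K) :=
  generated [set cox_gen i | i in [set i | mirror i x]].

Lemma local_group_subgroup x : is_subgroup (local_group x).
Proof.
split=> [H [[]]//|v w Hv Hw H HH|w Hw H HH].
- by have [[_ + _] _] := HH; apply; [exact: Hv|exact: Hw].
- by have [[_ _ +] _] := HH; apply; exact: Hw.
Qed.

Definition prebasic : Type := (discrete_topology (coxeter K) * chamber)%type.
HB.instance Definition _ := Topological.on prebasic.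

Definition basic_rel (p p' : prebasic) : bool :=
  `[< p.2 = p'.2 /\
      local_group (set_val p.2)
        ((p.1 : coxeter K)^-1 * (p'.1 : coxeter K))%g >].

Lemma basic_rel_equiv : equiv_class_of basic_rel.
Proof.
split=> [[v x]|[v x] [w y]|[w y] [v x] [u z]].
- apply/asboolP; split=> //=; rewrite mulVg.
  by have [] := local_group_subgroup (set_val x).
- apply/asboolP/asboolP => -[/= -> H]; split=> //.
    have [_ _ /(_ _ H)] := local_group_subgroup (set_val y).
    by rewrite invgM invgK.
  have [_ _ /(_ _ H)] := local_group_subgroup (set_val x).
  by rewrite invgM invgK.
- move=> /asboolP[/= <- Hvw] /asboolP[/= <- Hwu]; apply/asboolP; split=> //=.
  have [_ /(_ _ _ Hvw Hwu) + _] := local_group_subgroup (set_val x).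
  by rewrite -mulgA mulVKg.
Qed.

Canonical basic_equiv := EquivRelPack basic_rel_equiv.

Definition basic : Type := quotient_topology {eq_quot basic_equiv}.
HB.instance Definition _ := Topological.on basic.
HB.instance Definition _ := Quotient.on basic.

Definition basic_point (w : coxeter K) (x : chamber) : basic :=
  \pi_basic ((w, x) : prebasic).

Definition basic_act (w : coxeter K) (u : basic) : basic :=
  basic_point (w * ((repr u).1 : coxeter K))%g (repr u).2.

Lemma basic_pointP v x w y : basic_point v x = basic_point w y <->
  x = y /\ local_group (set_val x) (v^-1 * w)%g.
Proof.
set p : prebasic := (v, x); set p' : prebasic := (w, y).
have E : basic_point v x = basic_point w y <-> basic_rel p p'.
  by split=> [/(@eqmodP _ basic_equiv)|/(@eqmodP _ basic_equiv)].
by rewrite E; split=> [/asboolP|/asboolP].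
Qed.

Lemma basic_actE (w v : coxeter K) (x : chamber) :
  basic_act w (basic_point v x) = basic_point (w * v)%g x.
Proof.
rewrite /basic_act; set p := repr _.
have /basic_pointP[Ex H] : basic_point p.1 p.2 = basic_point v x.
  by rewrite /basic_point -surjective_pairing reprK.
by apply/basic_pointP; split=> //; rewrite invgM -mulgA mulKg.
Qed.

Definition flip (J : {set 'I_m}) (x : 'rV[R]_m) : 'rV[R]_m :=
  \row_i (if i \in J then - x 0 i else x 0 i).

End RealMomentAngle.

Arguments real_mac R {m} K.
Arguments chamber R {m} K.
Arguments basic R {m} K.

Definition homeomorphism (X Y : topologicalType) (f : X -> Y) : Prop :=
  continuous f /\
  exists g : Y -> X, [/\ continuous g, cancel f g & cancel g f].

Section UniversalCover.
Context (R : realType).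

Definition path_connected (X : topologicalType) : Prop :=
  forall x y : X, exists g : R -> X,
    [/\ {within `[0, 1], continuous g}, g 0 = x & g 1 = y].

Definition null_homotopic (X : topologicalType) (g : R -> X) : Prop :=
  exists H : R * R -> X,
    [/\ {within `[0, 1] `*` `[0, 1], continuous H},
        {in `[0, 1], forall t, H (t, 0) = g t},
        {in `[0, 1], forall t, H (t, 1) = g 0}
      & {in `[0, 1], forall s, H (0, s) = g 0 /\ H (1, s) = g 0}].

Definition simply_connected (X : topologicalType) : Prop :=
  [/\ [set: X] !=set0, path_connected X
    & forall g : R -> X, {within `[0, 1], continuous g} -> g 0 = g 1 ->
        null_homotopic g].

Definition evenly_covered (E B : topologicalType) (q : E -> B) (U : set B) :=
  exists F : set (set E),
    [/\ trivIset F id, q @^-1` U = \bigcup_(V in F) V &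
        forall V, F V -> open V /\
          exists s : B -> E,
            [/\ {within U, continuous s}, set_fun U V s,
                {in U, cancel s q} & {in V, cancel q s}]].

(* Fibres may be empty. *)
Definition covering_map (E B : topologicalType) (q : E -> B) : Prop :=
  continuous q /\
  forall b : B, exists U : set B, [/\ open U, U b & evenly_covered q U].

(* When the base is connected q is automatically onto; when it is not, this
   is the universal cover of one of its components. *)
Definition universal_cover (E B : topologicalType) (q : E -> B) : Prop :=
  simply_connected E /\ covering_map q.

(* W_K acts on the universal cover through lifts of the coordinate
   reflections x_i |-> - x_i, i in I: each s_i acts by a lift of the i-th
   reflection, and every lift of a composite of these reflections is the
   action of a unique element of W_K. *)
Definition reflection_lift_action (m : nat) (K : scomplex m)
    (E : topologicalType) (q : E -> real_mac R K)
    (act : coxeter K -> E -> E) : Prop :=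
  [/\ (forall e, act 1%g e = e),
      (forall v w e, act (v * w)%g e = act v (act w e)),
      (forall w, continuous (act w)),
      (forall i e, set_val (q (act (cox_gen i) e)) =
                   flip [set val i]%SET (set_val (q e)))
    & forall (J : {set 'I_m}) (f : E -> E),
        J \subset vertices K -> continuous f ->
        (forall e, set_val (q (f e)) = flip J (set_val (q e))) ->
        exists! w : coxeter K, act w = f].

End UniversalCover.

(* Main.v *)
(* Since an element of the basic construction U is a pair (w, x) with x in the
   chamber, (w, x) |-> (image of w in (Z/2)^I) . x maps U to the real
   moment-angle complex. It is a covering: over the open star of a point y the
   sheets are indexed by the chambers up to the stabilizer of |y|, which is
   elementary abelian because the zero coordinates of y form a simplex.

   U is simply connected. A word s in the generators gives a path in U from
   the base point (1, corner) to (word s, corner) crossing the mirrors one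
   after the other. Chambers, mirrors and intersections of two commuting
   mirrors are star-shaped, so that the relations of W_K are homotopies and
   every point of U acquires a canonical homotopy class of paths from the base
   point. Continuing a canonical class along any path gives a canonical class:
   this is local, hence follows by subdivision of the interval. A loop thus
   fixes by concatenation the class of its origin, and is null-homotopic.

   Finally, two simply connected coverings of a locally path-connected space
   whose images meet are isomorphic; flipping coordinates outside the vertex
   set moves the image of U to any given component. The action transported from
   U contains every lift of a product of reflections, since such a lift is
   determined by the image of one point, and W_K acts simply transitively on
   the translates of the corner. *)

Require Import Defs.
From HB Require Import structures.
From mathcomp Require Import all_boot all_order all_algebra.
From mathcomp Require Import generic_quotient.
From mathcomp Require Import all_classical all_reals all_analysis.
From mathcomp Require Import ring lra.

Set Implicit Arguments.
Unset Strict Implicit.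
Unset Printing Implicit Defensive.

Import Order.TTheory GRing.Theory Num.Theory.
Import numFieldNormedType.Exports.

Local Open Scope classical_set_scope.
Local Open Scope ring_scope.

(** * Interval induction and continuity *)

Section IntervalInduction.
Context (R : realType).

(** The supremum of the [t] in [a, b] with [P a t] cannot be less than [b], since the local
    hypothesis at the supremum carries [P] past it. *)
Lemma cousin (P : R -> R -> Prop) :
  (forall x y z, x <= y -> y <= z -> P x y -> P y z -> P x z) ->
  (forall t, exists2 d, 0 < d &
     forall x y, x <= y -> t - d < x -> y < t + d -> P x y) ->
  forall a b, a <= b -> P a b.
Proof.
move=> Ptrans Ploc a b ab.
have Pxx x : P x x.
  by have [d d0 Pd] := Ploc x; apply: Pd => //; lra.
pose S := [set t | a <= t <= b /\ P a t].
have Sa : S a by split; rewrite ?lexx.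
have Sb : ubound S b by move=> t [/andP[]].
have hS : has_sup S by split; [exists a|exists b].
have as_ : a <= sup S by apply: ub_le_sup => //; exists b.
have sb : sup S <= b by apply: ge_sup => //; exists a.
have [d d0 Pd] := Ploc (sup S).
have [t [/andP[at_ tb] Pat] td] := sup_adherent d0 hS.
have ts : t <= sup S by apply: ub_le_sup; [exists b|split; rewrite ?at_].
pose s' := Num.min b (sup S + d / 2).
have ts' : t <= s' by rewrite le_min tb /=; lra.
have s'd : s' < sup S + d by rewrite gt_min; apply/orP; right; lra.
have Ps' : P a s' by apply: (Ptrans a t s') => //; exact: Pd.
have Ss' : S s' by split => //; rewrite (le_trans at_ ts') ge_min lexx.
have : s' <= sup S by apply: ub_le_sup => //; exists b.
rewrite ge_min => /orP[bs|]; last by move=> ?; lra.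
have : s' = b by apply/min_idPl; lra.
by move=> <-.
Qed.

End IntervalInduction.

Section Gluing.
Context (R : realType).

(** Away from [k y = c] a single branch is used near [y]; on the interface both branches tend to the
    same value. *)
Lemma glue_at (Y X : topologicalType) (f g : Y -> X) (k : Y -> R) (c : R) y :
  {for y, continuous k} -> {for y, continuous f} -> {for y, continuous g} ->
  (k y = c -> f y = g y) ->
  {for y, continuous (fun y => if k y <= c then f y else g y)}.
Proof.
move=> ck cf cg fg; rewrite /prop_for /continuous_at => A.
suff : nbhs (if k y <= c then f y else g y) A ->
  nbhs y (fun z => A (if k z <= c then f z else g z)) by [].
have cf' : nbhs (f y) A -> nbhs y (fun z => A (f z)) := cf A.
have cg' : nbhs (g y) A -> nbhs y (fun z => A (g z)) := cg A.
have [kc|kc|kc] := ltgtP (k y) c => nA.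
- have H : nbhs y (fun z => k z < c) by exact: cvgr_lt ck _ kc.
  by apply: filterS2 H (cf' nA) => z kz Az; rewrite (ltW kz).
- have H : nbhs y (fun z => c < k z) by exact: cvgr_gt ck _ kc.
  by apply: filterS2 H (cg' nA) => z kz Az; rewrite leNgt kz.
- have nA' : nbhs (g y) A by rewrite -fg.
  by apply: filterS2 (cf' nA) (cg' nA') => z Az Az'; case: ifP.
Qed.

End Gluing.

Section ContinuityRules.
Context (R : realType) (X : topologicalType).
Implicit Types f g : X -> R.

Lemma cts_cst (Y : topologicalType) (y : Y) : continuous (fun _ : X => y).
Proof. by move=> x; exact: cvg_cst. Qed.

Lemma cts_id : continuous (fun x : X => x).
Proof. by move=> x; exact: cvg_id. Qed.

Lemma cts_comp (Y Z : topologicalType) (h : Y -> Z) (k : X -> Y) :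
  continuous h -> continuous k -> continuous (fun x => h (k x)).
Proof. by move=> ch ck x; apply: continuous_comp; [exact: ck|exact: ch]. Qed.

Lemma cts_pair (Y Z : topologicalType) (h : X -> Y) (k : X -> Z) :
  continuous h -> continuous k -> continuous (fun x => (h x, k x)).
Proof. by move=> ch ck x; apply: cvg_pair; [exact: ch|exact: ck]. Qed.

Lemma cts_fst (Y Z : topologicalType) (h : X -> Y * Z) :
  continuous h -> continuous (fun x => (h x).1).
Proof. by move=> ch; apply: cts_comp ch => x; exact: cvg_fst. Qed.

Lemma cts_snd (Y Z : topologicalType) (h : X -> Y * Z) :
  continuous h -> continuous (fun x => (h x).2).
Proof. by move=> ch; apply: cts_comp ch => x; exact: cvg_snd. Qed.

Lemma cts_add f g : continuous f -> continuous g ->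
  continuous (fun x => f x + g x).
Proof. by move=> cf cg x; apply: cvgD; [exact: cf|exact: cg]. Qed.

Lemma cts_opp f : continuous f -> continuous (fun x => - f x).
Proof. by move=> cf x; apply: cvgN; exact: cf. Qed.

Lemma cts_mul f g : continuous f -> continuous g ->
  continuous (fun x => f x * g x).
Proof. by move=> cf cg x; apply: cvgM; [exact: cf|exact: cg]. Qed.

Lemma cts_min f g : continuous f -> continuous g ->
  continuous (fun x => Num.min (f x) (g x)).
Proof. by move=> cf cg x; apply: continuous_min; [exact: cf|exact: cg]. Qed.

Lemma cts_max f g : continuous f -> continuous g ->
  continuous (fun x => Num.max (f x) (g x)).
Proof. by move=> cf cg x; apply: continuous_max; [exact: cf|exact: cg]. Qed.

Lemma cts_if (Y : topologicalType) (h k : X -> Y) f c :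
  continuous f -> continuous h -> continuous k ->
  (forall x, f x = c -> h x = k x) ->
  continuous (fun x => if f x <= c then h x else k x).
Proof.
move=> cf ch ck hk x; apply: glue_at; [exact: cf|exact: ch|exact: ck|].
exact: hk.
Qed.

End ContinuityRules.

(** The retraction of the line onto [0, 1]. Precomposing with it makes a path known on [0, 1]
    continuous on all of [R], so that homotopies need no subspace topology. *)
Definition clamp (R : realType) (t : R) : R := Num.min 1 (Num.max 0 t).

Section Clamp.
Context (R : realType).
Implicit Types s t : R.

Lemma clamp_ge0 t : 0 <= clamp t.
Proof. by rewrite le_min ler01 le_max lexx. Qed.

Lemma clamp_le1 t : clamp t <= 1.
Proof. by rewrite ge_min lexx. Qed.

Lemma clamp_itv t : clamp t \in `[0, 1].
Proof. by rewrite in_itv /= clamp_ge0 clamp_le1. Qed.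

Lemma clampE t : 0 <= t <= 1 -> clamp t = t.
Proof. by case/andP=> t0 t1; rewrite /clamp (max_idPr t0) (min_idPr t1). Qed.

Lemma clampK t : clamp (clamp t) = clamp t.
Proof. by rewrite clampE// clamp_ge0 clamp_le1. Qed.

Lemma clamp_le0 t : t <= 0 -> clamp t = 0.
Proof. by move=> t0; rewrite /clamp (max_idPl t0); apply/min_idPr. Qed.

Lemma clamp_ge1 t : 1 <= t -> clamp t = 1.
Proof.
move=> t1; rewrite /clamp; apply/min_idPl.
by rewrite le_max t1 orbT.
Qed.

Lemma clamp0 : clamp 0 = 0 :> R. Proof. exact: clamp_le0. Qed.
Lemma clamp1 : clamp 1 = 1 :> R. Proof. exact: clamp_ge1. Qed.

Lemma cts_clamp (X : topologicalType) (f : X -> R) :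
  continuous f -> continuous (fun x => clamp (f x)).
Proof.
by move=> cf; apply: cts_min; [exact: cts_cst|apply: cts_max => //;
  exact: cts_cst].
Qed.

Lemma within_cts (Y X : topologicalType) (A : set Y) (f : Y -> X)
    (Z : topologicalType) (k : Z -> Y) :
  {within A, continuous f} -> continuous k -> (forall z, A (k z)) ->
  continuous (fun z => f (k z)).
Proof.
move=> /subspace_continuousP cf ck kA z B /= nB.
have H : nbhs (k z) (fun y => A y -> B (f y)) := cf _ (kA z) _ nB.
have H' : nbhs z (fun w => A (k w) -> B (f (k w))) := ck z _ H.
suff : nbhs z (fun w => B (f (k w))) by [].
by apply: filterS H' => w; apply.
Qed.

End Clamp.

(* Directed by the syntax of the function: blind higher-order unification with
   the rules above is slow. *)
Ltac cts := lazymatch goal with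
  | |- forall x, continuous_at x (fun _ => ?c) => exact: cts_cst
  | |- forall x, continuous_at x (fun u => u) => exact: cts_id
  | |- forall x, continuous_at x id => exact: cts_id
  | |- forall x, continuous_at x fst => move=> ?; exact: cvg_fst
  | |- forall x, continuous_at x snd => move=> ?; exact: cvg_snd
  | |- forall x, continuous_at x (@clamp _) =>
      apply: (cts_clamp (f := fun u => u)); cts
  | |- forall x, continuous_at x (pair ?c) =>
      apply: (cts_pair (h := fun _ => c) (k := fun u => u)); cts
  | |- forall x, continuous_at x ( *%R ?c) =>
      apply: (cts_mul (f := fun _ => c) (g := fun u => u)); cts
  | |- forall x, continuous_at x (fun u => (@?f u, @?g u)) =>
      apply: (cts_pair (h := f) (k := g)); cts
  | |- forall x, continuous_at x (fun u => (@?f u).1) =>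
      apply: (cts_fst (h := f)); cts
  | |- forall x, continuous_at x (fun u => (@?f u).2) =>
      apply: (cts_snd (h := f)); cts
  | |- forall x, continuous_at x (fun u => clamp (@?f u)) =>
      apply: (cts_clamp (f := f)); cts
  | |- forall x, continuous_at x (fun u => Num.min (@?f u) (@?g u)) =>
      apply: (cts_min (f := f) (g := g)); cts
  | |- forall x, continuous_at x (fun u => Num.max (@?f u) (@?g u)) =>
      apply: (cts_max (f := f) (g := g)); cts
  | |- forall x, continuous_at x (fun u => @?f u + @?g u) =>
      apply: (cts_add (f := f) (g := g)); cts
  | |- forall x, continuous_at x (fun u => - @?f u) =>
      apply: (cts_opp (f := f)); cts
  | |- forall x, continuous_at x (fun u => @?f u * @?g u) =>
      apply: (cts_mul (f := f) (g := g)); cts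
  | |- _ => try assumption
  end.

(** * Path homotopies *)

Section PathHomotopy.
Context (R : realType) (X : topologicalType).
Implicit Types g h k : R -> X.

Definition path_cat g h : R -> X :=
  fun t => if t <= 2^-1 then g (2 * t) else h (2 * t - 1).

Definition path_rev g : R -> X := fun t => g (1 - t).

Definition subpath g a b : R -> X := fun t => g ((1 - t) * a + t * b).

Definition eq01 g h := forall t, 0 <= t <= 1 -> g t = h t.

(* Homotopy relative to the endpoints of the restrictions to [0,1]; values
   outside the unit interval are ignored by clamping. *)
Definition path_homotopic g h := exists H : R * R -> X,
  [/\ continuous H, (forall t, H (t, 0) = g (clamp t)),
      (forall t, H (t, 1) = h (clamp t))
    & forall s, H (0, s) = g 0 /\ H (1, s) = g 1].

Lemma path_cat0 g h : path_cat g h 0 = g 0.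
Proof. by rewrite /path_cat invr_ge0 ler0n mulr0. Qed.

Lemma path_cat1 g h : path_cat g h 1 = h 1.
Proof. by rewrite /path_cat ifF; [congr h; lra|apply/negbTE; lra]. Qed.

Lemma path_rev0 g : path_rev g 0 = g 1.
Proof. by rewrite /path_rev subr0. Qed.

Lemma path_rev1 g : path_rev g 1 = g 0.
Proof. by rewrite /path_rev subrr. Qed.

Lemma path_revK g : path_rev (path_rev g) = g.
Proof. by apply/funext => t; rewrite /path_rev; congr g; lra. Qed.

Lemma subpath0 g a b : subpath g a b 0 = g a.
Proof. by rewrite /subpath; congr g; lra. Qed.

Lemma subpath1 g a b : subpath g a b 1 = g b.
Proof. by rewrite /subpath; congr g; lra. Qed.

Lemma subpath01 g : subpath g 0 1 = g.
Proof. by apply/funext => t; rewrite /subpath; congr g; lra. Qed.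

Lemma cts_path_cat g h : continuous g -> continuous h -> g 1 = h 0 ->
  continuous (path_cat g h).
Proof.
move=> cg ch gh; apply: cts_if.
- exact: cts_id.
- by apply: (cts_comp cg); cts.
- by apply: (cts_comp ch); cts.
- move=> t ->; have -> : 2 * 2^-1 = 1 :> R by lra.
  by rewrite subrr.
Qed.

Lemma cts_path_rev g : continuous g -> continuous (path_rev g).
Proof. by move=> cg; apply: (cts_comp cg); cts. Qed.

Lemma cts_subpath g a b : continuous g -> continuous (subpath g a b).
Proof. by move=> cg; apply: (cts_comp cg); cts. Qed.

Lemma path_homotopic0 g h : path_homotopic g h -> g 0 = h 0.
Proof. by move=> [H [_ _ H1 /(_ 1)[<- _]]]; rewrite H1 clamp0. Qed.

Lemma path_homotopic1 g h : path_homotopic g h -> g 1 = h 1.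
Proof. by move=> [H [_ _ H1 /(_ 1)[_ <-]]]; rewrite H1 clamp1. Qed.

Lemma path_homotopic_sym g h : path_homotopic g h -> path_homotopic h g.
Proof.
move=> gh; have e0 := path_homotopic0 gh; have e1 := path_homotopic1 gh.
have [H [cH H0 H1 Hs]] := gh.
exists (fun p => H (p.1, 1 - p.2)); split.
- by apply: (cts_comp cH); cts.
- by move=> t /=; rewrite subr0.
- by move=> t /=; rewrite subrr.
- by move=> s /=; rewrite -e0 -e1; exact: Hs.
Qed.

Lemma path_homotopic_trans h g k :
  path_homotopic g h -> path_homotopic h k -> path_homotopic g k.
Proof.
move=> gh; have e0 := path_homotopic0 gh; have e1 := path_homotopic1 gh.
case: gh => H [cH H0 H1 Hs] [K [cK K0 K1 Ks]].
exists (fun p => if p.2 <= 2^-1 then H (p.1, 2 * p.2)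
                 else K (p.1, 2 * p.2 - 1)); split.
- apply: cts_if; [by cts|by apply: (cts_comp cH); cts|
    by apply: (cts_comp cK); cts|].
  move=> [t s] /= ->; have -> : 2 * 2^-1 = 1 :> R by lra.
  by rewrite subrr H1 K0.
- by move=> t /=; rewrite invr_ge0 ler0n mulr0.
- move=> t /=; rewrite ifF; last by apply/negbTE; lra.
  by rewrite -K1; congr (K (_, _)); lra.
- move=> s /=; case: ifP => _; first exact: Hs.
  by rewrite e0 e1; exact: Ks.
Qed.

Lemma path_homotopic_eq01 g g' h h' : eq01 g g' -> eq01 h h' ->
  path_homotopic g h -> path_homotopic g' h'.
Proof.
move=> gg' hh' [H [cH H0 H1 Hs]]; exists H; split => //.
- by move=> t; rewrite H0 gg'// clamp_ge0 clamp_le1.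
- by move=> t; rewrite H1 hh'// clamp_ge0 clamp_le1.
- by move=> s; rewrite -!gg' ?ler01 ?lexx//; exact: Hs.
Qed.

Lemma eq01_cat g g' h h' : eq01 g g' -> eq01 h h' ->
  eq01 (path_cat g h) (path_cat g' h').
Proof.
move=> gg' hh' t /andP[t0 t1]; rewrite /path_cat; case: ifPn => [?|].
  by apply: gg'; lra.
by rewrite -ltNge => ?; apply: hh'; lra.
Qed.

Lemma path_cat_congr g g' h h' : g 1 = h 0 ->
  path_homotopic g g' -> path_homotopic h h' ->
  path_homotopic (path_cat g h) (path_cat g' h').
Proof.
move=> gh [H [cH H0 H1 Hs]] [K [cK K0 K1 Ks]].
exists (fun p => if p.1 <= 2^-1 then H (2 * p.1, p.2)
                 else K (2 * p.1 - 1, p.2)); split.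
- apply: cts_if; [by cts|by apply: (cts_comp cH); cts|
    by apply: (cts_comp cK); cts|].
  move=> [t s] /= ->; have -> : 2 * 2^-1 = 1 :> R by lra.
  rewrite subrr; have [_ ->] := Hs s; have [-> _] := Ks s; exact: gh.
- move=> t /=; rewrite H0 K0 /path_cat.
  (* Clamping does not commute with doubling, so times before 0, in [0, 1] and after 1 are compared
     separately. *)
  have [t0|t0] := leP t 0.
    rewrite !(@clamp_le0 _ t)// ?(@clamp_le0 _ (2 * t)); [|lra].
    by rewrite !ifT ?mulr0; [|lra|lra].
  have [t1|t1] := leP t 1.
    by rewrite (@clampE _ t); [case: ifPn; rewrite -?ltNge => ?;
      rewrite clampE//; lra|lra].
  have -> : (t <= 2^-1) = false by apply/negbTE; lra.
  rewrite (clamp_ge1 (ltW t1));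
    have -> : (1 <= 2^-1 :> R) = false by apply/negbTE; lra.
  by rewrite clamp_ge1; [congr h|]; lra.
- move=> t /=; rewrite H1 K1 /path_cat.
  have [t0|t0] := leP t 0.
    rewrite !(@clamp_le0 _ t)// ?(@clamp_le0 _ (2 * t)); [|lra].
    by rewrite !ifT ?mulr0; [|lra|lra].
  have [t1|t1] := leP t 1.
    by rewrite (@clampE _ t); [case: ifPn; rewrite -?ltNge => ?;
      rewrite clampE//; lra|lra].
  have -> : (t <= 2^-1) = false by apply/negbTE; lra.
  rewrite (clamp_ge1 (ltW t1));
    have -> : (1 <= 2^-1 :> R) = false by apply/negbTE; lra.
  by rewrite clamp_ge1; [congr h'|]; lra.
- move=> s /=; rewrite path_cat0 path_cat1.
  have -> : (0 <= 2^-1 :> R) = true by rewrite invr_ge0 ler0n.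
  have -> : (1 <= 2^-1 :> R) = false by apply/negbTE; lra.
  have [H0s _] := Hs s; have [_ K1s] := Ks s.
  by rewrite mulr0 H0s -K1s; split => //; congr (K (_, _)); lra.
Qed.

End PathHomotopy.

Section PlaneHomotopy.
Context (R : realType) (X : topologicalType).
Implicit Types g h k : R -> X.

Lemma path_cat_comp (Y : topologicalType) (F : Y -> X) (phi psi : R -> Y) :
  (fun t => F (path_cat phi psi t)) =
  path_cat (fun t => F (phi t)) (fun t => F (psi t)).
Proof. by apply/funext => t; rewrite /path_cat; case: ifP. Qed.

(* A square, being convex, has only one homotopy class of paths between two
   given points: every identity of the path calculus comes from this one. *)
Lemma path_homotopic_plane (F : R * R -> X) (phi psi : R -> R * R) :
  continuous F -> continuous phi -> continuous psi ->
  phi 0 = psi 0 -> phi 1 = psi 1 ->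
  path_homotopic (fun t => F (phi t)) (fun t => F (psi t)).
Proof.
move=> cF cphi cpsi e0 e1.
exists (fun p => F ((1 - p.2) * (phi (clamp p.1)).1 + p.2 * (psi (clamp p.1)).1,
                    (1 - p.2) * (phi (clamp p.1)).2 + p.2 * (psi (clamp
                      p.1)).2)).
have cp : continuous (fun p : R * R => phi (clamp p.1)).
  by apply: (cts_comp cphi); cts.
have cq : continuous (fun p : R * R => psi (clamp p.1)).
  by apply: (cts_comp cpsi); cts.
split.
- by apply: (cts_comp cF); cts.
- move=> t /=; rewrite [in RHS](surjective_pairing (phi _)).
  by congr (F (_, _)); lra.
- move=> t /=; rewrite [in RHS](surjective_pairing (psi _)).
  by congr (F (_, _)); lra.
- move=> s /=; rewrite clamp0 clamp1 -e0 -e1.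
  rewrite [in X in _ = X /\ _](surjective_pairing (phi _)).
  rewrite [in X in _ /\ _ = X](surjective_pairing (phi _)).
  by split; congr (F (_, _)); lra.
Qed.

Lemma path_homotopic_reparam g (phi psi : R -> R) :
  continuous g -> continuous phi -> continuous psi ->
  phi 0 = psi 0 -> phi 1 = psi 1 ->
  path_homotopic (fun t => g (phi t)) (fun t => g (psi t)).
Proof.
move=> cg cphi cpsi e0 e1.
apply: (@path_homotopic_plane (fun p => g p.1) (fun t => (phi t, 0))
                              (fun t => (psi t, 0))).
- by apply: (cts_comp cg); cts.
- by cts.
- by cts.
- by rewrite e0.
- by rewrite e1.
Qed.

Lemma path_homotopic_refl g : continuous g -> path_homotopic g g.
Proof. by move=> cg; apply: (path_homotopic_reparam cg (phi := id) (psi :=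
  id)); cts. Qed.

Lemma eq01_homotopic g h : continuous g -> eq01 g h -> path_homotopic g h.
Proof.
by move=> cg gh; apply: path_homotopic_eq01 gh (path_homotopic_refl cg).
Qed.

Lemma path_catA g h k : continuous g -> continuous h -> continuous k ->
  g 1 = h 0 -> h 1 = k 0 ->
  path_homotopic (path_cat (path_cat g h) k) (path_cat g (path_cat h k)).
Proof.
move=> cg ch ck gh hk.
(* A single path on [0, 3] running through [g], [h] and [k]; both bracketings are reparametrizations
   of it with the same ends. *)
pose F t := if t <= 1 then g t else if t <= 2 then h (t - 1) else k (t - 2).
have cF : continuous F.
  apply: cts_if; [by cts|by []| |].
    apply: cts_if; [by cts|by apply: (cts_comp ch); cts|
                    by apply: (cts_comp ck); cts|].
    by move=> t ->; rewrite subrr -hk; congr h; lra.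
  by move=> t ->; rewrite ler1n subrr gh.
have Fg : eq01 F g by move=> t /andP[t0 t1]; rewrite /F t1.
have Fh : eq01 (fun t => F (t + 1)) h.
  move=> t /andP[t0 t1]; rewrite /F; case: ifPn => [t1'|_].
    by have -> : t = 0 by [lra|]; rewrite add0r gh.
  by rewrite ifT; [congr h; lra|lra].
have Fk : eq01 (fun t => F (t + 2)) k.
  move=> t /andP[t0 t1]; rewrite /F ifF; last by apply/negbTE; lra.
  case: ifPn => [t1'|_]; last by congr k; lra.
  have -> : t = 0 by lra.
  by rewrite add0r -hk; congr h; lra.
pose f1 (t : R) := t + 1; pose f2 (t : R) := t + 2.
have := @path_homotopic_reparam F (path_cat (path_cat id f1) f2)
   (path_cat id (path_cat f1 f2)) cF.
rewrite !(path_cat_comp F) => H; apply: path_homotopic_eq01 (H _ _ _ _).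
- by do 2!apply: eq01_cat => //.
- by do 2!apply: eq01_cat => //.
- apply: cts_path_cat; [apply: cts_path_cat; [by cts|by rewrite /f1; cts|]
    |by rewrite /f2; cts|]; rewrite ?path_cat1 /f1 /f2; lra.
- apply: cts_path_cat; [by cts|apply: cts_path_cat;
    [by rewrite /f1; cts|by rewrite /f2; cts|]|];
  rewrite ?path_cat0 /f1 /f2; lra.
- by rewrite !path_cat0.
- by rewrite !path_cat1.
Qed.

Lemma path_catV g : continuous g ->
  path_homotopic (path_cat g (path_rev g)) (fun _ => g 0).
Proof.
move=> cg; have := @path_homotopic_reparam g
  (path_cat id (fun t => 1 - t)) (fun=> 0) cg.
rewrite (path_cat_comp g); apply; [|by cts| |].
- by apply: cts_path_cat; [by cts|by cts|rewrite subr0].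
- by rewrite path_cat0.
- by rewrite path_cat1 subrr.
Qed.

Lemma path_cat1r g : continuous g ->
  path_homotopic (path_cat g (fun _ => g 1)) g.
Proof.
move=> cg; have := @path_homotopic_reparam g (path_cat id (fun=> 1)) id cg.
rewrite (path_cat_comp g); apply; [|by cts| |].
- by apply: cts_path_cat; [by cts|by cts|].
- by rewrite path_cat0.
- by rewrite path_cat1.
Qed.

Lemma path_cat1l g : continuous g ->
  path_homotopic (path_cat (fun _ => g 0) g) g.
Proof.
move=> cg; have := @path_homotopic_reparam g (path_cat (fun=> 0) id) id cg.
rewrite (path_cat_comp g); apply; [|by cts| |].
- by apply: cts_path_cat; [by cts|by cts|].
- by rewrite path_cat0.
- by rewrite path_cat1.
Qed.

Lemma path_catK g h : continuous g -> continuous h -> g 1 = h 0 ->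
  path_homotopic (path_cat (path_cat g h) (path_rev h)) g.
Proof.
move=> cg ch gh; have crh := cts_path_rev ch.
have hr : h 1 = path_rev h 0 by rewrite path_rev0.
apply: path_homotopic_trans (path_catA cg ch crh gh hr) _.
apply: path_homotopic_trans _ (path_cat1r cg).
apply: path_cat_congr; first by rewrite path_cat0.
- exact: path_homotopic_refl.
- by rewrite gh; exact: path_catV.
Qed.

Lemma path_catVK g h : continuous g -> continuous h -> g 1 = h 1 ->
  path_homotopic (path_cat (path_cat g (path_rev h)) h) g.
Proof.
move=> cg ch gh; rewrite -{2}(path_revK h); apply: path_catK => //.
  exact: cts_path_rev.
by rewrite path_rev0.
Qed.

Lemma path_cat_congrl g g' h : g 1 = h 0 -> continuous h ->
  path_homotopic g g' -> path_homotopic (path_cat g h) (path_cat g' h).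
Proof. by move=> gh ch gg'; apply: path_cat_congr => //;
  exact: path_homotopic_refl. Qed.

Lemma path_cat_congrr g h h' : g 1 = h 0 -> continuous g ->
  path_homotopic h h' -> path_homotopic (path_cat g h) (path_cat g h').
Proof. by move=> gh ch gg'; apply: path_cat_congr => //;
  exact: path_homotopic_refl. Qed.

Lemma subpath_cat g a b c : continuous g ->
  path_homotopic (subpath g a c) (path_cat (subpath g a b) (subpath g b c)).
Proof.
move=> cg; rewrite -(path_cat_comp g); apply: path_homotopic_reparam => //.
- by cts.
- by apply: cts_path_cat; [by cts|by cts|lra].
- by rewrite path_cat0; lra.
- by rewrite path_cat1; lra.
Qed.

(** The left, top and reversed right sides form a planar path with the same ends as the bottom
    side. *)
Lemma path_homotopic_square (F : R * R -> X) : continuous F ->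
  path_homotopic
    (path_cat (path_cat (fun t => F (0, t)) (fun t => F (t, 1)))
              (path_rev (fun t => F (1, t))))
    (fun t => F (t, 0)).
Proof.
move=> cF; rewrite /path_rev -(path_cat_comp F (fun t => (0, t))).
rewrite -(path_cat_comp F _ (fun t => (1, 1 - t))).
apply: path_homotopic_plane => //.
- apply: cts_path_cat; [apply: cts_path_cat|by cts|]; [by cts|by cts|by []|].
  by rewrite path_cat1 subr0.
- by cts.
- by rewrite !path_cat0.
- by rewrite path_cat1 subrr.
Qed.

(** Left cancellation: [h] is homotopic to (g^-1 g) h, then to g^-1 (g h), then to g^-1 g. *)
Lemma path_cat_fix_null g h : continuous g -> continuous h -> g 1 = h 0 ->
  path_homotopic (path_cat g h) g -> path_homotopic h (fun=> h 0).
Proof.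
move=> cg ch gh ghg.
have crg := cts_path_rev cg; have rg : path_rev g 1 = g 0 by rewrite path_rev1.
have cgh := cts_path_cat cg ch gh.
have Vg : path_homotopic (path_cat (path_rev g) g) (fun=> h 0).
  by rewrite -gh -(path_rev0 g) -{2}(path_revK g); exact: path_catV.
apply: path_homotopic_trans (path_homotopic_sym (path_cat1l ch)) _.
apply: (path_homotopic_trans _ Vg).
apply: (@path_homotopic_trans _ _ (path_cat (path_cat (path_rev g) g) h)).
  by apply: path_cat_congrl => //; apply: path_homotopic_sym; exact: Vg.
apply: path_homotopic_trans (path_catA crg cg ch rg gh) _.
by apply: path_cat_congrr => //; rewrite path_cat0.
Qed.

Lemma path_homotopic_null g :
  path_homotopic g (fun=> g 0) -> null_homotopic g.
Proof.
move=> gg; have /= e1 := path_homotopic1 gg.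
have [H [cH H0 H1 Hs]] := gg; exists H; split.
- exact: continuous_subspaceT.
- by move=> t /[!in_itv]/= t01; rewrite H0 clampE.
- by move=> t _; rewrite H1.
- by move=> s _; have [-> ->] := Hs s; rewrite e1.
Qed.

Lemma null_homotopic_eq01 g h : eq01 g h -> null_homotopic g -> null_homotopic
  h.
Proof.
move=> gh [H [cH H0 H1 Hs]]; have gh0 : g 0 = h 0 by apply: gh;
  rewrite lexx ler01.
exists H; split => //; rewrite -?gh0//.
by move=> t t01; rewrite H0// gh//; move: t01; rewrite in_itv.
Qed.

End PlaneHomotopy.

(** * Covering spaces *)

Section Coverings.
Context (R : realType).

Lemma cts_near (X Y : topologicalType) (f g : X -> Y) x :
  nbhs x (fun z => f z = g z) -> {for x, continuous f} ->
  {for x, continuous g}.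
Proof.
move=> fg cf A; rewrite -(nbhs_singleton fg) => nA.
have H : nbhs x (fun z => A (f z)) := cf A nA.
suff : nbhs x (fun z => A (g z)) by [].
by apply: filterS2 fg H => z ->.
Qed.

Lemma cts_at_comp (X Y Z : topologicalType) (f : Y -> Z) (g : X -> Y) x :
  {for x, continuous g} -> {for g x, continuous f} ->
  {for x, continuous (fun z => f (g z))}.
Proof. by move=> cg cf; apply: continuous_comp. Qed.

Section Sheets.
Context (E B : topologicalType) (q : E -> B).

(** One sheet over an open [U] with its section. As [U] is open, continuity within [U] is continuity
    at each of its points, which composes more easily. *)
Definition sheet (U : set B) (V : set E) (s : B -> E) :=
  [/\ open V, V `<=` q @^-1` U,
      (forall b, U b -> {for b, continuous s}),
      (forall b, U b -> V (s b) /\ q (s b) = b)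
    & forall e, V e -> s (q e) = e].

Lemma covering_sheets : covering_map q -> forall b, exists U : set B,
  [/\ open U, U b & exists F : set (set E), [/\ trivIset F id,
    (forall e, U (q e) -> exists2 V, F V & V e)
    & forall V, F V -> exists s, sheet U V s]].
Proof.
move=> [cq +] b => /(_ b)[U [oU Ub [F [tF qF sF]]]]; exists U; split => //.
exists F; split => //.
- by move=> e Ue; have : (q @^-1` U) e by []; rewrite qF => -[V FV Ve];
  exists V.
- move=> V FV; have [oV [s [cs fs qs sq]]] := sF V FV; exists s; split => //.
  + by rewrite qF => e Ve; exists V.
  + move=> c Uc; move: cs; rewrite continuous_open_subspace//; apply.
    exact: mem_set.
  + move=> c Uc; split; first exact: fs.
    by apply: qs; exact: mem_set.
  + by move=> e Ve; apply: sq; exact: mem_set.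
Qed.

Lemma covering_sheet : covering_map q -> forall e, exists U V s,
  [/\ open U, U (q e), V e & sheet U V s].
Proof.
move=> cq e; have [U [oU Ue [F [_ /(_ _ Ue)[V FV Ve] /(_ V FV)[s sh]]]]] :=
  covering_sheets cq (q e).
by exists U, V, s.
Qed.

(** The equivalence of agreement at [a] and agreement at [b] is transitive and local: near a given
    time each lift stays in one sheet; a common sheet forces equality, distinct sheets are disjoint
    and forbid it. Interval induction concludes. *)
Lemma lift_unique (g1 g2 : R -> E) a b : covering_map q ->
  continuous g1 -> continuous g2 -> (forall t, q (g1 t) = q (g2 t)) ->
  g1 a = g2 a -> g1 b = g2 b.
Proof.
move=> cq c1 c2 q12.
pose P a b := g1 a = g2 a <-> g1 b = g2 b.
suff HP : forall a b, a <= b -> P a b.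
  by case: (leP a b) => [|/ltW] /HP[].
apply: cousin => [x y z _ _ xy yz|t]; first exact: iff_trans xy yz.
have [U [oU Ut [F [tF FU FS]]]] := covering_sheets cq (q (g1 t)).
have [V1 FV1 V1t] := FU _ Ut.
have [V2 FV2 V2t] : exists2 V, F V & V (g2 t) by apply: FU; rewrite -q12.
have [s1 [oV1 _ _ _ s1K]] := FS _ FV1; have [s2 [oV2 _ _ _ _]] := FS _ FV2.
have n1 : nbhs t (fun x => V1 (g1 x)) by apply: c1; exact: open_nbhs_nbhs.
have n2 : nbhs t (fun x => V2 (g2 x)) by apply: c2; exact: open_nbhs_nbhs.
have n12 : nbhs t (fun x => V1 (g1 x) /\ V2 (g2 x)) by exact: filterI.
have [d /= d0 dB] := (nbhs_ballP _ _).1 n12.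
exists d => // x y xy tx yt.
have [V1x V2x] : V1 (g1 x) /\ V2 (g2 x).
  by apply: dB; rewrite /ball /= ltr_norml; lra.
have [V1y V2y] : V1 (g1 y) /\ V2 (g2 y).
  by apply: dB; rewrite /ball /= ltr_norml; lra.
have [E12|N12] := pselect (V1 = V2).
  rewrite -E12 in V2x V2y.
  by split=> _; [rewrite -(s1K _ V1y) -(s1K _ V2y) q12|
                 rewrite -(s1K _ V1x) -(s1K _ V2x) q12].
by split=> e12; case: N12; apply: (tF _ _ FV1 FV2);
  [exists (g1 x); split => //; rewrite e12|exists (g1 y); split => //;
    rewrite e12].
Qed.

Lemma lift_unique01 (g1 g2 : R -> E) : covering_map q ->
  continuous g1 -> continuous g2 ->
  (forall t, 0 <= t <= 1 -> q (g1 t) = q (g2 t)) ->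
  g1 0 = g2 0 -> g1 1 = g2 1.
Proof.
move=> cq c1 c2 q12 e0.
have := @lift_unique (fun t => g1 (clamp t)) (fun t => g2 (clamp t)) 0 1 cq.
rewrite clamp0 clamp1; apply => //.
- by apply: (cts_comp c1); cts.
- by apply: (cts_comp c2); cts.
- by move=> t; apply: q12; rewrite clamp_ge0 clamp_le1.
Qed.

Let clip (a b t : R) := Num.min b (Num.max a t).

Section HomotopyLifting.
Context (X : topologicalType) (F : X * R -> B) (f0 : X -> E).
Hypotheses (cq : covering_map q) (cF : continuous F) (cf0 : continuous f0).
Hypothesis qf0 : forall x, q (f0 x) = F (x, 0).

(** Quantifying over all initial lifts [f] makes this extension property transitive, as interval
    induction demands. Freezing time by [clip] lets [G] be a lift at all times. *)
Let local_lift (x0 : X) (a b : R) := forall (N : set X) (f : X -> E),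
  nbhs x0 N -> (forall x, N x -> {for x, continuous f}) ->
  (forall x, N x -> q (f x) = F (x, a)) ->
  exists (N' : set X) (G : X * R -> E), [/\ nbhs x0 N', N' `<=` N,
    (forall x t, N' x -> {for (x, t), continuous G}),
    (forall x t, N' x -> q (G (x, t)) = F (x, clip a b t))
  & forall x, N' x -> G (x, a) = f x].

Let local_lift_trans x0 a b c : a <= b -> b <= c ->
  local_lift x0 a b -> local_lift x0 b c -> local_lift x0 a c.
Proof.
move=> ab bc Lab Lbc N f nN cf qf.
have [N1 [G1 [nN1 N1N cG1 qG1 G1a]]] := Lab N f nN cf qf.
have [||N2 [G2 [nN2 N21 cG2 qG2 G2b]]] := Lbc N1 (fun x => G1 (x, b)) nN1.
- move=> x N1x; apply: (@cts_at_comp _ _ _ G1 (fun x => (x, b))).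
    exact: (cts_pair (@cts_id X) (@cts_cst X R b)).
  exact: cG1.
- by move=> x N1x; rewrite qG1//; congr (F (_, _));
  rewrite /clip /Num.max /Num.min; do 2!case: ifP; lra.
exists N2, (fun p => if p.2 <= b then G1 p else G2 p); split => //.
- by move=> x /N21/N1N.
- move=> x t N2x; apply: glue_at.
  + by move: (x, t); apply: cts_snd; cts.
  + exact/cG1/N21.
  + exact: cG2.
  + by move=> /= ->; rewrite G2b.
- move=> x t N2x /=; case: ifPn => tb;
  [rewrite (qG1 _ _ (N21 _ N2x))|rewrite (qG2 _ _ N2x)];
  by congr (F (_, _)); rewrite /clip /Num.max /Num.min; do !case: ifP; lra.
- by move=> x N2x /=; rewrite ab; exact/G1a/N21.
Qed.

(** A box around (x0, t) is mapped into one evenly covered set; there the lift is [F] followed by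
    the section of the sheet containing [f x0], for those [x] whose [f x] is in that sheet too. *)
Let local_lift_near x0 t : exists2 d, 0 < d &
  forall a b, a <= b -> t - d < a -> b < t + d -> local_lift x0 a b.
Proof.
have [U [oU Ut [S [_ SU SS]]]] := covering_sheets cq (F (x0, t)).
have : nbhs (x0, t) (fun p => U (F p)) by apply: cF; exact: open_nbhs_nbhs.
move=> [[N0 D] /= [nN0 nD] ND].
have [d /= d0 dD] := (nbhs_ballP _ _).1 nD.
exists d => // a b ab ta bt N f nN cf qf.
have clipD r : D (clip a b r).
  apply: dD; rewrite /ball /= ltr_norml /clip /Num.max /Num.min.
  by do !case: ifP; lra.
have Ucl x r : N0 x -> U (F (x, clip a b r)).
  by move=> N0x; apply: (ND (x, _)); split=> /=; [exact: N0x|exact: clipD].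
have clipa : clip a b a = a by rewrite /clip maxxx; apply/min_idPr; exact: ab.
have Ux0 : U (q (f x0)).
  by rewrite (qf _ (nbhs_singleton nN)) -clipa; apply: Ucl;
    exact: nbhs_singleton.
have [V SV Vx0] := SU _ Ux0; have [s [oV VU cs sV sK]] := SS V SV.
exists (fun x => N x /\ N0 x /\ V (f x)), (fun p => s (F (p.1, clip a b p.2))).
split.
- apply: filterI => //; apply: filterI => //.
  by apply: (cf x0 (nbhs_singleton nN)); exact: open_nbhs_nbhs.
- by move=> x [].
- move=> x r [Nx [N0x Vx]].
  apply: (@cts_at_comp _ _ _ s (fun p => F (p.1, clip a b p.2)));
    last exact/cs/Ucl.
  by move: (x, r); apply: (cts_comp cF); rewrite /clip; cts.
- by move=> x r [_ [N0x _]] /=; have [] := sV _ (Ucl x r N0x).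
- by move=> x [Nx [N0x Vx]] /=; rewrite clipa -qf// sK.
Qed.

Lemma homotopy_lifting : exists G : X * R -> E, [/\ continuous G,
  (forall x t, q (G (x, t)) = F (x, clamp t)) & forall x, G (x, 0) = f0 x].
Proof.
have loc (x0 : X) : exists NG : set X * (X * R -> E), [/\ nbhs x0 NG.1,
    (forall x t, NG.1 x -> {for (x, t), continuous NG.2}),
    (forall x t, NG.1 x -> q (NG.2 (x, t)) = F (x, clamp t))
  & forall x, NG.1 x -> NG.2 (x, 0) = f0 x].
  have L : local_lift x0 0 1.
    apply: (@cousin _ (local_lift x0)) => // x y z xy yz.
    exact: local_lift_trans.
  have [||N [G [nN _ cG qG G0]]] := L setT f0 filterT.
  - by move=> x _; exact: cf0.
  - by move=> x _; exact: qf0.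
  by exists (N, G).
have [NG HNG] := choice loc.
(* At each [x] the value comes from the local lift chosen for [x] itself; uniqueness of lifts along
   the times over [x] identifies it with any other local lift defined there, which gives
   continuity. *)
pose G p := (NG p.1).2 p.
have G_eq (x0 x : X) (t : R) : (NG x0).1 x -> (NG x0).2 (x, t) = G (x, t).
  move=> N0x; have [nN0 c0 q0 G0] := HNG x0; have [nN c1 q1 G1] := HNG x.
  have Nx := nbhs_singleton nN.
  apply: (@lift_unique (fun t => (NG x0).2 (x, t)) (fun t => (NG x).2 (x,
    t)) 0 t
    cq).
  - move=> r; apply: (@cts_at_comp _ _ _ (NG x0).2 (fun t => (x, t))).
      exact: (cts_pair (@cts_cst R X x) (@cts_id R)).
    exact: c0.
  - move=> r; apply: (@cts_at_comp _ _ _ (NG x).2 (fun t => (x, t))).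
      exact: (cts_pair (@cts_cst R X x) (@cts_id R)).
    exact: c1.
  - by move=> r; rewrite q0 ?q1.
  - by rewrite G0 ?G1.
exists G; split.
- move=> [x0 t]; have [nN c0 q0 G0] := HNG x0.
  apply: (@cts_near _ _ (NG x0).2); last by apply: c0; exact: nbhs_singleton.
  exists ((NG x0).1, setT) => /=; first by split; [exact: nN|exact: filterT].
  by move=> [x r] /= [Nx _]; exact: G_eq.
- by move=> x t; have [/nbhs_singleton Nx _ qx _] := HNG x; exact: qx.
- by move=> x; have [/nbhs_singleton Nx _ _ Gx] := HNG x; exact: Gx.
Qed.

End HomotopyLifting.

Lemma path_lifting (g : R -> B) e0 : covering_map q -> continuous g ->
  q e0 = g 0 -> exists l : R -> E,
    [/\ continuous l, forall t, 0 <= t <= 1 -> q (l t) = g t & l 0 = e0].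
Proof.
move=> cq cg qe.
have cF : continuous (fun p : R * R => g p.2) by apply: (cts_comp cg); cts.
have ce : continuous (fun _ : R => e0) by cts.
have [//|G [cG qG G0]] := @homotopy_lifting R _ _ cq cF ce.
exists (fun t => G (0, t)); split => //.
- by apply: (cts_comp cG); cts.
- by move=> t t01; rewrite qG /= clampE.
Qed.

End Sheets.

(** A form suited to sections and lifts: the paths start at the centre [x] and stay in [N], while
    [N'] itself may fail to be path connected. *)
Definition locally_path_connected (X : topologicalType) :=
  forall (x : X) (N : set X), nbhs x N -> exists N' : set X,
    nbhs x N' /\ forall x', N' x' -> exists d : R -> X,
      [/\ continuous d, d 0 = x, d 1 = x' & forall t, N (d t)].

Lemma path_connected_cts (X : topologicalType) (x y : X) :
  path_connected R X ->
  exists g : R -> X, [/\ continuous g, g 0 = x & g 1 = y].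
Proof.
move=> /(_ x y)[g [cg g0 g1]]; exists (fun t => g (clamp t)).
rewrite clamp0 clamp1; split => //; apply: (within_cts cg); first by cts.
by move=> t; exact: clamp_itv.
Qed.

Lemma lift_unique_connected (X E B : topologicalType) (q : E -> B)
    (g1 g2 : X -> E) x0 :
  covering_map q -> path_connected R X -> continuous g1 -> continuous g2 ->
  (forall x, q (g1 x) = q (g2 x)) -> g1 x0 = g2 x0 -> g1 = g2.
Proof.
move=> cq pX c1 c2 q12 e0; apply/funext => x.
have [g [cg g0 g1']] := path_connected_cts x0 x pX.
have := @lift_unique _ _ q (fun t => g1 (g t)) (fun t => g2 (g t)) 0 1 cq.
by rewrite g0 g1'; apply => //; [exact: (cts_comp c1)|exact: (cts_comp c2)].
Qed.

Lemma locally_path_connected_cover (E B : topologicalType) (q : E -> B) :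
  covering_map q -> locally_path_connected B -> locally_path_connected E.
Proof.
move=> cq lB e N nN; have [U [V [s [oU Ue Ve [oV VU cs sV sK]]]]] :=
  covering_sheet cq e.
have nW : nbhs (q e) (fun b => U b /\ N (s b)).
  apply: filterI; first exact: open_nbhs_nbhs.
  by apply: (cs _ Ue); rewrite sK.
have [N' [nN' HN']] := lB _ _ nW.
exists (fun e' => V e' /\ N' (q e')); split.
  apply: filterI; first exact: open_nbhs_nbhs.
  by apply: cq.1.
move=> e' [Ve' /HN'[d [cd d0 d1 dW]]]; exists (fun t => s (d t)); split.
- move=> t; apply: (@cts_at_comp _ _ _ s d); first exact: cd.
  by apply: cs; have [] := dW t.
- by rewrite d0 sK.
- by rewrite d1 sK.
- by move=> t; have [] := dW t.
Qed.

(** Monodromy: lifting a contraction of the loop [g] followed by reversed [g'] shows that the lift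
    of its image from [l 0] is closed. The halves of this lift are [l] and the reverse of [l'],
    which therefore meet at time 1/2. *)
Lemma lift_end_unique (X E B : topologicalType) (q : E -> B) (f : X -> B)
    (g g' : R -> X) (l l' : R -> E) :
  simply_connected R X -> covering_map q -> continuous f ->
  continuous g -> continuous g' -> g 0 = g' 0 -> g 1 = g' 1 ->
  continuous l -> continuous l' -> l 0 = l' 0 ->
  (forall t, 0 <= t <= 1 -> q (l t) = f (g t)) ->
  (forall t, 0 <= t <= 1 -> q (l' t) = f (g' t)) ->
  l 1 = l' 1.
Proof.
move=> [_ _ sX] cq cf cg cg' g0 g1 cl cl' l0 ql ql'.
have crg' := cts_path_rev cg'.
pose k := path_cat g (path_rev g').
have ck : continuous k by apply: cts_path_cat => //; rewrite path_rev0.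
have k0 : k 0 = g 0 by rewrite /k path_cat0.
have k1 : k 1 = g 0 by rewrite /k path_cat1 path_rev1.
have [||H [cH H0 H1 Hs]] := sX k.
- exact: continuous_subspaceT.
- by rewrite k0 k1.
have cH' : continuous (fun p : R * R => H (clamp p.2, clamp p.1)).
  apply: (within_cts cH); first by cts.
  by move=> p; split; exact: clamp_itv.
(* The arguments of [H] are exchanged: the first coordinate is the stage of the contraction, the
   second the time that is lifted. *)
have [||p|G [cG qG G0]] := @homotopy_lifting _ _ q R
   (fun p => f (H (clamp p.2, clamp p.1))) (fun=> l 0) cq.
- exact: (cts_comp cf).
- by cts.
- by rewrite ql ?lexx ?ler01//= clamp0 (Hs _ (clamp_itv _)).1 k0.
have qG0 t : q (G (0, clamp t)) = f (k (clamp t)).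
  by rewrite qG /= clamp0 !clampK (H0 _ (clamp_itv _)).
have cGx (phi psi : R -> R) : continuous phi -> continuous psi ->
    continuous (fun t => G (phi t, psi t)).
  by move=> cp cs; apply: (cts_comp cG); cts.
(* Three sides of the square lie over one point, so [G] is constant along them. *)
have G11 : G (1, 1) = l 0.
  rewrite -(G0 1); apply: (@lift_unique _ _ q (fun t => G (1, t)) (fun=> G (1,
    0)) 0 1 cq) => //.
  - by apply: cGx; cts.
  - by cts.
  - by move=> t; rewrite !qG /= clamp1 !(H1 _ (clamp_itv _)).
have G01 : G (0, 1) = l 0.
  rewrite -G11; apply: (@lift_unique _ _ q (fun t => G (t, 1)) (fun=> G (1,
    1)) 1 0 cq) => //.
  - by apply: cGx; cts.
  - by cts.
  - by move=> t; rewrite !qG /= !clamp1 !(Hs _ _).2 ?clamp_itv// in_itv /=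
    ler01 lexx.
have <- : G (0, 2^-1) = l 1.
  rewrite -[2^-1](_ : 1 / 2 = _); last by lra.
  apply: (@lift_unique01 _ _ q (fun t => G (0, t / 2)) l) => //.
  - by apply: cGx; cts.
  - move=> t t01; rewrite ql//.
    have <- : clamp (t / 2) = t / 2 by apply: clampE; lra.
    rewrite qG0 clampE /k /path_cat; last by lra.
    by rewrite ifT; [congr (f (g _)); lra|lra].
  - by rewrite mul0r.
have -> : G (0, 2^-1) = G (0, 1 - 1 / 2) by congr (G (_, _)); lra.
apply: (@lift_unique01 _ _ q (fun t => G (0, 1 - t / 2)) l') => //.
- by apply: cGx; cts.
- move=> t t01; rewrite ql'//.
  have <- : clamp (1 - t / 2) = 1 - t / 2 by apply: clampE; lra.
  rewrite qG0 clampE /k /path_cat; last by lra.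
  case: ifPn => ht; last by rewrite /path_rev; congr (f (g' _)); lra.
  have -> : t = 1 by lra.
  by rewrite -g1; congr (f (g _)); lra.
- by rewrite mul0r subr0 G01.
Qed.

(** The lift sends [x] to the end of the lift of any path from [x0] to [x]; by [lift_end_unique] the
    choice of path does not matter. *)
Lemma lifting_criterion (X E B : topologicalType) (q : E -> B) (f : X -> B)
    x0 e0 :
  simply_connected R X -> locally_path_connected X -> covering_map q ->
  continuous f -> q e0 = f x0 -> exists g : X -> E,
    [/\ continuous g, forall x, q (g x) = f x & g x0 = e0].
Proof.
move=> sX lX cq cf qe0.
have exl x : exists gl : (R -> X) * (R -> E), [/\
    continuous gl.1 /\ continuous gl.2, gl.1 0 = x0, gl.1 1 = x, gl.2 0 = e0
  & forall t, 0 <= t <= 1 -> q (gl.2 t) = f (gl.1 t)].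
  have [_ pX _] := sX; have [g [cg g0 g1]] := path_connected_cts x0 x pX.
  have [||l [cl ql l0]] := @path_lifting _ _ q (fun t => f (g t)) e0 cq.
  - exact: (cts_comp cf).
  - by rewrite g0.
  by exists (g, l).
have {exl}[gl Hgl] := choice exl.
have endE x (g : R -> X) (l : R -> E) : continuous g -> continuous l ->
    g 0 = x0 -> g 1 = x -> l 0 = e0 ->
    (forall t, 0 <= t <= 1 -> q (l t) = f (g t)) -> (gl x).2 1 = l 1.
  move=> cg cl g0 g1 l0 ql; have [[cg' cl'] g0' g1' l0' ql'] := Hgl x.
  apply: (lift_end_unique sX cq cf cg' cg _ _ cl' cl _ ql' ql).
  - by rewrite g0'.
  - by rewrite g1'.
  - by rewrite l0'.
have qgl x : q ((gl x).2 1) = f x.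
  by have [_ _ g1' _ ->] := Hgl x; rewrite ?ler01 ?lexx// g1'.
exists (fun x => (gl x).2 1); split => //.
- move=> x.
  have [U [V [s [oU Ue Ve [oV VU cs sV sK]]]]] := covering_sheet cq ((gl x).2
    1).
  rewrite qgl in Ue.
  have nN : nbhs x (fun z => U (f z)) by apply: cf; exact: open_nbhs_nbhs.
  have [N' [nN' HN']] := lX _ _ nN.
  apply: (@cts_near _ _ (fun z => s (f z))); last first.
    by apply: (@cts_at_comp _ _ _ s f); [exact: cf|exact: cs].
  (* Prolonging the path to [x] by a short path [d] whose image stays in [U] shows that the lift
     equals [s] after [f] near [x]. *)
  apply: filterS nN' => x' /HN'[d [cd d0 d1 dU]]; apply/esym.
  have [[cg cl] g0 g1 l0 ql] := Hgl x.
  have csd : continuous (fun t => s (f (d t))).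
    move=> t; apply: (@cts_at_comp _ _ _ s (fun t => f (d t))).
      exact: (cts_comp cf).
    exact: cs.
  have lsd : (gl x).2 1 = s (f (d 0)) by rewrite d0 -qgl sK.
  rewrite (@endE _ (path_cat (gl x).1 d) (path_cat (gl x).2 (fun t => s (f (d
    t))))).
  + by rewrite path_cat1 d1.
  + by apply: cts_path_cat => //; rewrite g1.
  + exact: cts_path_cat.
  + by rewrite path_cat0.
  + by rewrite path_cat1.
  + by rewrite path_cat0.
  + move=> t t01; rewrite /path_cat; case: ifPn => th.
      by apply: ql; lra.
    by have [] := sV _ (dU (2 * t - 1)).
- rewrite (@endE _ (fun=> x0) (fun=> e0)) //; by cts.
Qed.

(** Each projection lifts through the other; the composites lift a projection through itself and fix
    a base point, so they are identities. *)
Lemma universal_cover_unique (E E' B : topologicalType) (q : E -> B)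
    (q' : E' -> B) e0 e0' :
  locally_path_connected B -> universal_cover R q -> universal_cover R q' ->
  q e0 = q' e0' ->
  exists h : E -> E', homeomorphism h /\ forall e, q' (h e) = q e.
Proof.
move=> lB [sE cq] [sE' cq'] qq'.
have lE := locally_path_connected_cover cq lB.
have lE' := locally_path_connected_cover cq' lB.
have [h [ch qh h0]] := lifting_criterion sE lE cq' cq.1 (esym qq').
have [h' [ch' qh' h0']] := lifting_criterion sE' lE' cq cq'.1 qq'.
exists h; split => //; split => //; exists h'; split => //.
- have [_ pE _] := sE; move=> e; apply: (congr1 (@^~ e) (_ : h' \o h = id));
  apply: (@lift_unique_connected _ _ _ q _ _ e0) => //=.
  + exact: (cts_comp ch').
  + exact: cts_id.
  + by move=> x; rewrite qh' qh.
  + by rewrite h0.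
- have [_ pE _] := sE'; move=> e; apply: (congr1 (@^~ e) (_ : h \o h' = id));
  apply: (@lift_unique_connected _ _ _ q' _ _ e0') => //=.
  + exact: (cts_comp ch).
  + exact: cts_id.
  + by move=> x; rewrite qh qh'.
  + by rewrite h0'.
Qed.

End Coverings.

(** * Words in the Coxeter group *)

Section CoxeterWords.
Context (m : nat) (K : scomplex m).
Implicit Types (s t : seq (vert K)) (v w : coxeter K) (i j : vert K).

(* The abelianization W_K -> (Z/2)^I, as a set of coordinates to reflect. *)
Definition parity_word s : {set 'I_m} :=
  [set k | odd (count (fun i => val i == k) s)]%SET.

Definition parity w := parity_word (repr w).

(** Every relator contains each generator an even number of times. *)
Lemma coxeter_eq_parity s t : coxeter_eq s t -> parity_word s = parity_word t.
Proof.
move=> st; apply/setP => k; rewrite !inE; elim: st => //=.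
- by move=> s1 s2 s3 _ -> _ ->.
- by move=> s1 s2 s3 s4 _ + _ +; rewrite !count_cat !oddD => -> ->.
- by move=> i; rewrite addn0 addnn odd_double.
- move=> i j _; rewrite addn0 !oddD !oddb.
  by case: (val i == k); case: (val j == k).
Qed.

Lemma parity_wordE s : parity (word s) = parity_word s.
Proof. exact/coxeter_eq_parity/coxeter_eq_repr. Qed.

Lemma word0 : word [::] = 1%g :> coxeter K. Proof. by []. Qed.

Lemma wordM s t : (word s * word t)%g = word (s ++ t).
Proof. exact: coxeter_mulE. Qed.

Lemma wordV s : ((word s)^-1)%g = word (rev s).
Proof.
apply: (@mulgI _ (word s)); rewrite mulgV wordM; apply/esym/wordP.
by rewrite -{1}[s]revK; exact: coxeter_eq_rev.
Qed.

Lemma parityM v w k :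
  (k \in parity (v * w)%g) = (k \in parity v) (+) (k \in parity w).
Proof.
elim/coxeter_ind: v => s; elim/coxeter_ind: w => t.
by rewrite wordM !parity_wordE !inE count_cat oddD.
Qed.

Lemma parity1 k : (k \in parity (1%g : coxeter K)) = false.
Proof. by rewrite -word0 parity_wordE inE. Qed.

Lemma parityV w : parity (w^-1)%g = parity w.
Proof.
elim/coxeter_ind: w => s; rewrite wordV !parity_wordE.
by apply/setP => k; rewrite !inE count_rev.
Qed.

Definition word_of (J : {set 'I_m}) : seq (vert K) :=
  [seq i <- enum {: vert K} | val i \in J].

Lemma parity_word_of (J : {set 'I_m}) : J \subset vertices K -> parity_word
  (word_of J) = J.
Proof.
move=> JK; apply/setP => k; rewrite inE count_filter.
have [kJ|kJ] := boolP (k \in J).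
  have kK : k \in vertices K := fintype.subsetP JK k kJ.
  rewrite (@eq_count _ _ (pred1 (exist _ k kK : vert K))); last first.
    move=> i /=; rewrite -[LHS]/((val i == k) && (val i \in J)) -[RHS]val_eqE
      /=.
    by case: eqP => // ->.
  by rewrite count_uniq_mem ?enum_uniq// mem_enum.
rewrite (@eq_count _ _ pred0) ?count_pred0// => i /=.
by apply/negbTE; apply: contra kJ => /andP[/eqP <-].
Qed.

Lemma mem_word_of (J : {set 'I_m}) i : i \in word_of J -> val i \in J.
Proof. by rewrite mem_filter => /andP[]. Qed.

Lemma coxeter_commute i s : (forall j, j \in s -> [set val i;
  val j]%SET \in K) ->
  (word [:: i] * word s)%g = (word s * word [:: i])%g.
Proof.
have sqr j : (word [:: j] * word [:: j])%g = 1%g.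
  by rewrite wordM; apply/wordP/CoxSquare.
elim: s => [|j s IH] iK; first by rewrite word0 mulg1 mul1g.
rewrite -[j :: s]/([:: j] ++ s) -wordM -[RHS]mulgA -IH; last first.
  by move=> k ks; apply: iK; rewrite inE ks orbT.
rewrite !mulgA; congr (_ * _)%g.
have : (word [:: i] * word [:: j] * word [:: i] * word [:: j])%g = 1%g.
  by rewrite !wordM; apply/wordP/CoxComm/iK; rewrite inE eqxx.
move=> /(congr1 (fun g => g * word [:: j] * word [:: i])%g).
by rewrite mul1g -[X in (X * _)%g = _]mulgA sqr mulg1 -[LHS]mulgA sqr mulg1.
Qed.

Lemma simplex_pair (J : {set 'I_m}) a b : J \in (K : {set {set 'I_m}}) -> a \in
  J -> b \in J ->
  [set a; b]%SET \in K.
Proof.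
move=> JK aJ bJ; apply: simplexS JK.
by apply/fintype.subsetP => k; rewrite !inE => /orP[/eqP->|/eqP->].
Qed.

(* The subgroup generated by the vertices of a simplex is elementary abelian,
   so a word in these letters is determined by its parity. *)
Lemma simplex_word_parity0 (J : {set 'I_m}) s : J \in (K : {set {set 'I_m}}) ->
  (forall i, i \in s -> val i \in J) -> parity_word s = finset.set0 ->
  word s = 1%g.
Proof.
move=> JK; have [n] := ubnP (size s); elim: n s => // n IH [//|i s] /=.
rewrite ltnS => sn sJ ps.
(* The letter [i] has even count in the whole word, so it occurs again in the tail; commuting the
   first occurrence up to the second cancels both. *)
have /splitPr is' : i \in s.
  move/setP/(_ (val i)): ps; rewrite !inE /= eqxx /= => /negbFE/odd_gt0.
  rewrite -has_count => /hasP[j js]; rewrite val_eqE => /eqP <-.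
  by [].
case: is' sn sJ ps => a b sn sJ ps.
rewrite -[i :: _]/([:: i] ++ (a ++ ([:: i] ++ b))) -!wordM !mulgA
  coxeter_commute.
  have sqr : (word [:: i] * word [:: i])%g = 1%g.
    by rewrite wordM; apply/wordP/CoxSquare.
  rewrite -(mulgA (word a)) sqr mulg1 wordM; apply: IH.
  - by move: sn; rewrite !size_cat /= addnS => /ltnW.
  - by move=> j; rewrite mem_cat => jab; apply: sJ; rewrite inE mem_cat inE;
      case/orP: jab => ->; rewrite ?orbT.
  - apply/setP => k; move/setP/(_ k): ps; rewrite !inE /= !count_cat /=.
    by rewrite !oddD; case: (val i == k) => <-; case: odd; case: odd.
move=> j ja; apply: (@simplex_pair J) => //; apply: sJ;
  first by rewrite inE eqxx.
by rewrite inE mem_cat ja orbT.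
Qed.

End CoxeterWords.

(** * Local groups as sets of words *)

Section LocalGroup.
Context (R : realType) (m : nat) (K : scomplex m).
Implicit Types x : 'rV[R]_m.

Definition zeros x : {set 'I_m} := [set k | x 0 k == 0]%SET.

Lemma in_zeros x k : (k \in zeros x) = (x 0 k == 0).
Proof. by rewrite inE. Qed.

(** The words in the vanishing coordinates form a subgroup containing the generators of the local
    group, so they exhaust it. *)
Lemma local_groupP x (g : coxeter K) : chamber R K x ->
  local_group x g <-> exists s, (forall i,
    i \in s -> val i \in zeros x) /\ g = word s.
Proof.
move=> Cx; split.
- move=> /(_ [set g | exists s, (forall i,
  i \in s -> val i \in zeros x) /\ g = word s]).
  apply; split.
    split.
    + by exists [::].
    + move=> _ _ [s [sx ->]] [t [tx ->]]; exists (s ++ t); rewrite wordM;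
      split => //.
      by move=> i; rewrite mem_cat => /orP[/sx|/tx].
    + move=> _ [s [sx ->]]; exists (rev s); rewrite wordV; split => //.
      by move=> i; rewrite mem_rev => /sx.
  move=> _ [i [_ xi] <-]; exists [:: i]; split => // j.
  by rewrite !inE => /eqP ->; rewrite xi.
- move=> [s [sx ->]] H [[H1 HM _] Hgen].
  elim: s sx => [//|i s IH] sx.
  rewrite -[i :: s]/([:: i] ++ s) -wordM; apply: HM.
    apply: Hgen; exists i => //; split => //.
    by apply/eqP; have := sx i; rewrite !inE eqxx; exact.
  by apply: IH => j js; apply: sx; rewrite inE js orbT.
Qed.

(** The parities of [s] and [t] differ in a set [D] of vanishing coordinates. All letters lie in one
    simplex, so parity decides equality and the quotient is the word of [D]. *)
Lemma local_group_simplex x (J : {set 'I_m}) (s t : seq (vert K)) :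
  chamber R K x -> J \in (K : {set {set 'I_m}}) ->
  (forall i, i \in s -> val i \in J) -> (forall i, i \in t -> val i \in J) ->
  (forall k, k \in parity_word s -> k \notin parity_word t -> k \in zeros x) ->
  (forall k, k \in parity_word t -> k \notin parity_word s -> k \in zeros x) ->
  local_group x ((word s)^-1 * word t)%g.
Proof.
move=> Cx JK sJ tJ sx tx; apply/local_groupP => //.
pose D := [set k | (k \in parity_word s) (+) (k \in parity_word t)]%SET.
have DJ : D \subset J.
  apply/fintype.subsetP => k; rewrite !inE.
  case: (boolP (odd _)) => [/odd_gt0 + _|_ /= /odd_gt0].
    by rewrite -has_count => /hasP[i /sJ + /eqP <-].
  by rewrite -has_count => /hasP[i /tJ + /eqP <-].
have DK : D \subset vertices K.
  apply/fintype.subsetP => k /(fintype.subsetP DJ) kJ; rewrite inE;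
    apply: simplexS JK.
  by rewrite finset.sub1set.
exists (word_of K D); split.
  move=> i /mem_word_of; rewrite inE.
  by case: (boolP (_ \in parity_word s)) => [/sx H /H|/[swap]/= /tx H /H].
apply: (@mulgI _ (word (word_of K D))^-1%g); rewrite mulVg !wordV.
rewrite (wordM (rev s) t) (wordM (rev _) (rev s ++ t)).
apply: (simplex_word_parity0 JK).
  move=> i; rewrite !mem_cat !mem_rev => /orP[/mem_word_of/(fintype.subsetP
    DJ)//|].
  by case/orP => h; [exact: sJ|exact: tJ].
apply/setP => k; rewrite !inE !count_cat !count_rev !oddD.
have := parity_word_of DK => /setP/(_ k); rewrite !inE => ->.
by case: (odd _); case: (odd _).
Qed.

End LocalGroup.

(** * The real moment-angle complex *)

Section SetRetract.
Context (T : topologicalType) (A : set T) (a0 : A).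

(** A total left inverse of [set_val], with default value [a0]: points of a subspace are given by
    ambient formulas and membership is proved afterwards. *)
Definition to_set (x : T) : A :=
  match pselect (A x) with
  | left Ax => exist _ x (mem_set Ax)
  | right _ => a0
  end.

Lemma to_setE x : A x -> set_val (to_set x) = x.
Proof. by rewrite /to_set; case: pselect. Qed.

Lemma set_val_inj : injective (set_val : A -> T).
Proof. exact: val_inj. Qed.

Lemma to_setK a : to_set (set_val a) = a.
Proof. by apply: set_val_inj; rewrite to_setE//; exact: set_valP. Qed.

Lemma cts_to_set (Y : topologicalType) (f : Y -> T) :
  continuous f -> (forall y, A (f y)) -> continuous (fun y => to_set (f y)).
Proof.
move=> cf Af; apply: (@continuous_comp_initial _ _ _ set_val).
suff -> : set_val \o (fun y => to_set (f y)) = f by [].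
by apply/funext => y /=; exact: to_setE.
Qed.

Lemma cts_set_val (Y : topologicalType) (f : Y -> A) :
  continuous f -> continuous (fun y => set_val (f y)).
Proof. by move=> cf; apply: (cts_comp _ cf); exact: initial_continuous. Qed.

End SetRetract.

Lemma convex_gt (R : realType) (a u v t : R) : a < u -> a < v ->
  0 <= t <= 1 -> a < (1 - t) * u + t * v.
Proof.
move=> au av /andP[]; rewrite le_eqVlt => /orP[/eqP <- _|t0 t1]; first by lra.
by nra.
Qed.

Lemma convex_lt (R : realType) (a u v t : R) : u < a -> v < a ->
  0 <= t <= 1 -> (1 - t) * u + t * v < a.
Proof.
move=> au av t01; have := @convex_gt R (- a) (- u) (- v) t.
by rewrite !ltrN2 => /(_ au av t01); lra.
Qed.

(** * Segments, reflections and open stars in coordinates *)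

Section RowContinuity.
Context (R : realType) (m : nat).
Implicit Types (x y z : 'rV[R]_m) (J : {set 'I_m}).

Lemma nbhs_coord x (P : 'I_m -> set R) : (forall i, nbhs (x 0 i) (P i)) ->
  nbhs x (fun y => forall i, P i (y 0 i)).
Proof.
move=> nP; apply: (@filter_forall _ _ (fun i y => P i (y 0 i)) _ (nbhs_filter
  x)) => i.
exact: (@coord_continuous R 1 m 0 i x _ (nP i)).
Qed.

Lemma cts_row (Y : topologicalType) (f : Y -> 'rV[R]_m) :
  (forall i, continuous (fun u => f u 0 i)) -> continuous f.
Proof.
move=> cf u A [P nP PA].
have H : nbhs u (fun v => forall i, P 0 i (f v 0 i)).
  apply: (@filter_forall _ _ (fun i v => P 0 i (f v 0 i)) _ (nbhs_filter u)) =>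
    i.
  exact: (cf i u _ (nP 0 i)).
suff : nbhs u (fun v => A (f v)) by [].
by apply: filterS H => v Pv; apply: PA => k i; rewrite (ord1 k).
Qed.

Lemma cts_coord (Y : topologicalType) (f : Y -> 'rV[R]_m) i :
  continuous f -> continuous (fun u => f u 0 i).
Proof. by move=> cf; exact: (cts_comp (@coord_continuous R 1 m 0 i) cf). Qed.

Definition segment x y (t : R) : 'rV[R]_m := \row_i ((1 - t) * x 0 i + t * y 0
  i).

Lemma segment0 x y : segment x y 0 = x.
Proof. by apply/rowP => i; rewrite mxE; lra. Qed.

Lemma segment1 x y : segment x y 1 = y.
Proof. by apply/rowP => i; rewrite mxE; lra. Qed.

Lemma cts_segment (Y : topologicalType) (f g : Y -> 'rV[R]_m) (t : Y -> R) :
  continuous f -> continuous g -> continuous t ->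
  continuous (fun u => segment (f u) (g u) (t u)).
Proof.
move=> cf cg ct; apply: cts_row => i.
rewrite (_ : (fun _ => _) =
  (fun u => (1 - t u) * f u 0 i + t u * g u 0 i)); last first.
  by apply/funext => u; rewrite mxE.
have cfi := @cts_coord _ f i cf; have cgi := @cts_coord _ g i cg.
by cts.
Qed.

Definition absr x : 'rV[R]_m := \row_i `|x 0 i|.

Lemma cts_absr (Y : topologicalType) (f : Y -> 'rV[R]_m) :
  continuous f -> continuous (fun u => absr (f u)).
Proof.
move=> cf; apply: cts_row => i.
rewrite (_ : (fun _ => _) = (fun u => `|f u 0 i|)); last first.
  by apply/funext => u; rewrite mxE.
apply: (@cts_comp _ _ _ (fun r : R => `|r|)); last exact: cts_coord.
exact: norm_continuous.
Qed.

Lemma flipE J x i : flip J x 0 i = if i \in J then - x 0 i else x 0 i.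
Proof. by rewrite mxE. Qed.

Lemma cts_flip (Y : topologicalType) J (f : Y -> 'rV[R]_m) :
  continuous f -> continuous (fun u => flip J (f u)).
Proof.
move=> cf; apply: cts_row => i; have cfi := @cts_coord _ f i cf.
rewrite (_ : (fun _ => _) = (fun u => if i \in J then - f u 0 i else f u 0 i)).
  by case: (i \in J); cts.
by apply/funext => u; rewrite flipE.
Qed.

Lemma flipK J : involutive (@flip R m J).
Proof. by move=> x; apply/rowP => i; rewrite !flipE; case: (i \in J);
  rewrite ?opprK. Qed.

Lemma flip_comm J J' x : flip J (flip J' x) = flip J' (flip J x).
Proof. by apply/rowP => i; rewrite !flipE; case: (i \in J);
  case: (i \in J'). Qed.

Lemma absr_flip J x : absr (flip J x) = absr x.
Proof. by apply/rowP => i; rewrite !mxE; case: ifP; rewrite ?normrN. Qed.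

Lemma absr_id x : (forall i, 0 <= x 0 i) -> absr x = x.
Proof. by move=> x0; apply/rowP => i; rewrite mxE ger0_norm. Qed.

Lemma segment_flip J x y t : segment (flip J x) (flip J y) t = flip J (segment
  x y t).
Proof. by apply/rowP => i; rewrite !mxE; case: ifP => _ //; lra. Qed.

(* The open star of y for the subdivision of the cube by the coordinate
   hyperplanes. *)
Definition star y : set 'rV[R]_m := [set z | forall i,
  [/\ 0 < y 0 i -> 0 < z 0 i, y 0 i < 0 -> z 0 i < 0
    & `|y 0 i| < 1 -> `|z 0 i| < 1]].

Lemma star_refl y : star y y.
Proof. by []. Qed.

Lemma open_star y : open (star y).
Proof.
rewrite openE => z yz; rewrite /interior.
pose P i (r : R) := [/\ 0 < y 0 i -> 0 < r, y 0 i < 0 -> r < 0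
    & `|y 0 i| < 1 -> `|r| < 1].
apply: (@nbhs_coord z P) => i; have [z0 z1 z2] := yz i.
have n0 : nbhs (z 0 i) (fun r => 0 < y 0 i -> 0 < r).
  case: (boolP (0 < y 0 i)) => [/z0 zi|_]; last by apply: filterS filterT.
  by apply: filterS (lt_nbhsr zi) => r.
have n1 : nbhs (z 0 i) (fun r => y 0 i < 0 -> r < 0).
  case: (boolP (y 0 i < 0)) => [/z1 zi|_]; last by apply: filterS filterT.
  by apply: filterS (lt_nbhsl zi) => r.
have n2 : nbhs (z 0 i) (fun r => `|y 0 i| < 1 -> `|r| < 1).
  case: (boolP (`|y 0 i| < 1)) => [/z2|_]; last by apply: filterS filterT.
  rewrite ltr_norml => /andP[a b].
  apply: filterS2 (lt_nbhsl b) (lt_nbhsr a) => r r1 r2 _.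
  by rewrite ltr_norml r1 r2.
by apply: filterS3 n0 n1 n2 => r; split.
Qed.

Lemma star_segment y z t : star y z -> 0 <= t <= 1 -> star y (segment z y t).
Proof.
move=> yz t01 i; have [z0 z1 z2] := yz i; rewrite !mxE; split.
- by move=> h; apply: convex_gt => //; exact: z0.
- by move=> h; apply: convex_lt => //; exact: z1.
- move=> h; have := z2 h; move: h.
  rewrite !ltr_norml => /andP[a b] /andP[c d].
  by rewrite convex_gt// convex_lt.
Qed.

Lemma star_flip J y z : star y z -> star (flip J y) (flip J z).
Proof.
move=> yz i; have [z0 z1 z2] := yz i; rewrite !flipE.
by case: ifP => // _; rewrite !oppr_gt0 !oppr_lt0 !normrN.
Qed.

Lemma star_zero y z i : star y z -> z 0 i = 0 -> y 0 i = 0.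
Proof.
move=> /(_ i)[z0 z1 _] zi; rewrite zi ltxx in z0 z1.
by have [/z1|/z0|] := ltgtP (y 0 i) 0.
Qed.

(** The third star condition forces absolute value 1 at [y], and the first two match the signs.
    Hence a segment from [z] to [y] meets the freezing hypothesis of [real_mac_segment]. *)
Lemma star_norm1 y z i : star y z -> `|y 0 i| <= 1 -> `|z 0 i| = 1 ->
  y 0 i = z 0 i.
Proof.
move=> /(_ i)[z0 z1 z2] y1 zi; rewrite zi ltxx in z2.
have {y1 z2} : `|y 0 i| = 1.
  by apply/eqP; rewrite eq_le y1 /= leNgt; apply/negP => /z2.
move: zi; have [/z1 h|/z0 h|->] := ltgtP (y 0 i) 0.
- by rewrite (ltr0_norm h); case: ltrgt0P => //; lra.
- by rewrite (gtr0_norm h); case: ltrgt0P => //; lra.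
- by rewrite normr0; lra.
Qed.

End RowContinuity.

Section RealMac.
Context (R : realType) (m : nat) (K : scomplex m).
Implicit Types (x y z : 'rV[R]_m) (J : {set 'I_m}).

Definition interior_coords x : {set 'I_m} := [set i | `|x 0 i| < 1]%SET.

(** The interior coordinates form the smallest [J] that can witness membership, and simplices are
    closed under subsets. *)
Lemma real_macP x : real_mac R K x <->
  (forall i, `|x 0 i| <= 1) /\ interior_coords x \in (K : {set {set 'I_m}}).
Proof.
split=> [[J JK Jx]|[x1 xK]].
  have xJ i : if i \in J then `|x 0 i| <= 1 else `|x 0 i| == 1.
    have := Jx i; case: ifP => _ /=; first by rewrite in_itv /= ler_norml.
    by case=> ->; rewrite ?normrN normr1.
  split=> [i|]; first by have := xJ i; case: ifP => // _ /eqP ->.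
  apply: simplexS JK; apply/fintype.subsetP => i; rewrite inE.
  by have := xJ i; case: ifP => // _ /eqP ->; rewrite ltxx.
exists (interior_coords x) => // i; have := x1 i; rewrite inE.
case: ifP => [_|/negbT]; first by rewrite /= in_itv /= ler_norml.
rewrite -leNgt => h1 h2; have : `|x 0 i| == 1 by rewrite eq_le h1 h2.
by rewrite eqr_norml ler01 andbT => /orP[/eqP|/eqP]; [left|right].
Qed.

Lemma real_mac_norm x i : real_mac R K x -> `|x 0 i| <= 1.
Proof. by case/real_macP. Qed.

Lemma real_mac_sub x y : real_mac R K x -> (forall i, `|y 0 i| <= 1) ->
  (forall i, `|y 0 i| < 1 -> `|x 0 i| < 1) -> real_mac R K y.
Proof.
move=> /real_macP[_ xK] y1 yx; apply/real_macP; split => //.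
apply: simplexS xK; apply/fintype.subsetP => i; rewrite !inE; exact: yx.
Qed.

Lemma real_mac_flip x J : real_mac R K x -> real_mac R K (flip J x).
Proof.
move=> Mx; have nf i : `|flip J x 0 i| = `|x 0 i|.
  by rewrite flipE; case: ifP; rewrite ?normrN.
by apply: (real_mac_sub Mx) => i; rewrite nf//; exact: real_mac_norm.
Qed.

Lemma chamber_absr x : real_mac R K x -> chamber R K (absr x).
Proof.
move=> Mx; split; last by move=> i; rewrite mxE.
by apply: (real_mac_sub Mx) => i; rewrite mxE normr_id//; exact: real_mac_norm.
Qed.

(** Coordinates equal to 1 or -1 at [x] stay frozen, so the segment has no interior coordinate
    beyond those of [x]. *)
Lemma real_mac_segment x y t : real_mac R K x -> real_mac R K y ->
  (forall i, `|x 0 i| = 1 -> y 0 i = x 0 i) -> 0 <= t <= 1 ->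
  real_mac R K (segment x y t).
Proof.
move=> Mx My xy /andP[t0 t1]; apply: (real_mac_sub Mx) => i; rewrite mxE.
  have := real_mac_norm i Mx; have := real_mac_norm i My.
  by rewrite !ler_norml => /andP[a b] /andP[c d]; apply/andP; split; nra.
have := real_mac_norm i Mx; rewrite le_eqVlt => /orP[/eqP xi|//].
rewrite (xy _ xi) (_ : (1 - t) * x 0 i + t * x 0 i = x 0 i)//; lra.
Qed.

Lemma chamber_ge0 x i : chamber R K x -> 0 <= x 0 i.
Proof. by case. Qed.

Lemma chamber_segment x y t : chamber R K x -> chamber R K y ->
  (forall i, x 0 i = 1 -> y 0 i = 1) -> 0 <= t <= 1 ->
  chamber R K (segment x y t).
Proof.
move=> Cx Cy xy /[dup] t01 /andP[t0 t1]; split; last first.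
  move=> i; rewrite mxE; have := chamber_ge0 i Cx; have := chamber_ge0 i Cy.
  by nra.
apply: real_mac_segment => //; [by case: Cx|by case: Cy|] => i.
by rewrite ger0_norm ?(chamber_ge0 i Cx)// => xi; rewrite xi xy.
Qed.

Definition corner : 'rV[R]_m := \row_i 1.

(** For a simplex [J], the vertex of the cubical chamber lying on exactly the mirrors of [J]; the
    empty simplex gives the corner. *)
Definition face_center J : 'rV[R]_m := \row_i (i \notin J)%:R.

Lemma chamber_face_center J : J \in (K : {set {set 'I_m}}) ->
  chamber R K (face_center J).
Proof.
move=> JK; split; last by move=> i; rewrite mxE.
apply/real_macP; split=> [i|]; first by rewrite mxE; case: (_ \notin _);
  rewrite ?normr1 ?normr0.
apply: simplexS JK; apply/fintype.subsetP => i; rewrite inE mxE.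
by case: (i \in J) => //=; rewrite normr1 ltxx.
Qed.

Lemma chamber_corner : chamber R K corner.
Proof.
have := chamber_face_center (simplex0 K).
by rewrite (_ : face_center _ = corner)//; apply/rowP => i; rewrite !mxE inE.
Qed.

Lemma zeros_simplex x : real_mac R K x -> zeros x \in (K : {set {set 'I_m}}).
Proof.
move=> /real_macP[_ xK]; apply: simplexS xK; apply/fintype.subsetP => i.
by rewrite !inE => /eqP ->; rewrite normr0.
Qed.

Lemma simplex_vertices J : J \in (K : {set {set 'I_m}}) -> J \subset vertices K.
Proof.
move=> JK; apply/fintype.subsetP => i iJ; rewrite inE; apply: simplexS JK.
by rewrite finset.sub1set.
Qed.

Lemma real_mac_locally_path_connected :
  locally_path_connected R (real_mac R K).
Proof.
move=> y N [W [[W' oW' <-] Wy WN]].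
have := open_nbhs_nbhs (conj oW' Wy).
move/nbhs_ballP => [e /= e0 eW].
exists (fun z : real_mac R K => ball (set_val y) e (set_val z) /\ star (set_val
  y) (set_val z)).
split.
  apply: filterI.
    apply: (@initial_continuous _ _ set_val y (ball (set_val y) e)).
    exact: nbhsx_ballx.
  apply: (@initial_continuous _ _ set_val y (star (set_val y))).
  by apply: open_nbhs_nbhs; split; [exact: open_star|exact: star_refl].
move=> z [yz sz].
(* The segment goes from [z] to [y], since [y] shares the boundary coordinates of [z] but not
   conversely; the path below runs it backwards. *)
have Mseg t : real_mac R K (segment (set_val z) (set_val y) (clamp t)).
  apply: real_mac_segment;
    rewrite ?clamp_ge0 ?clamp_le1 ?[real_mac _ _ _]set_valP//.
  - exact: set_valP.
  - exact: set_valP.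
  - move=> i zi; apply: star_norm1 zi => //.
    by apply: real_mac_norm; exact: set_valP.
exists (fun t => to_set y (segment (set_val z) (set_val y) (clamp (1 - t))));
  split.
- by apply: cts_to_set => //; apply: cts_segment; cts.
- by rewrite subr0 clamp1 segment1 to_setK.
- by rewrite subrr clamp0 segment0 to_setK.
- move=> t; apply: WN; apply: eW => /=; rewrite to_setE//; split => // k i.
  have [_ /(_ k i)] := yz; rewrite (ord1 k) mxE /ball /= !ltr_norml.
  have := clamp_ge0 (1 - t); have := clamp_le1 (1 - t).
  by move=> ? ? /andP[? ?]; apply/andP; split; nra.
Qed.

End RealMac.

(** * The covering by the basic construction *)

Section Unfolding.
Context (R : realType) (m : nat) (K : scomplex m).
Implicit Types (v w g : coxeter K) (x : chamber R K) (y : 'rV[R]_m).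
Implicit Types (u : basic R K) (b : real_mac R K).

Definition chamber_corner_pt : chamber R K :=
  exist _ (corner R m) (mem_set (chamber_corner R K)).

Definition to_chamber : 'rV[R]_m -> chamber R K := to_set chamber_corner_pt.

Lemma real_mac_corner : real_mac R K (corner R m).
Proof. by case: (chamber_corner R K). Qed.

Definition real_mac_corner_pt : real_mac R K :=
  exist _ (corner R m) (mem_set real_mac_corner).

Definition to_real_mac : 'rV[R]_m -> real_mac R K := to_set real_mac_corner_pt.

Lemma chamber_valP x : chamber R K (set_val x).
Proof. exact: set_valP. Qed.

Lemma real_mac_valP b : real_mac R K (set_val b).
Proof. exact: set_valP. Qed.

Lemma chamber_real_mac y : chamber R K y -> real_mac R K y.
Proof. by case. Qed.

Lemma local_group_parity y g k : chamber R K y -> local_group y g ->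
  k \in parity g -> k \in zeros y.
Proof.
move=> Cy /(local_groupP _ Cy)[s [sy ->]]; rewrite parity_wordE inE.
by move=> /odd_gt0; rewrite -has_count => /hasP[i /sy + /eqP <-].
Qed.

Lemma local_groupS y z g : chamber R K y -> chamber R K z ->
  (forall i, y 0 i = 0 -> z 0 i = 0) -> local_group y g -> local_group z g.
Proof.
move=> Cy Cz yz /(local_groupP _ Cy)[s [sy ->]]; apply/local_groupP => //.
by exists s; split => // i /sy; rewrite !inE => /eqP/yz/eqP.
Qed.

(** Computed on a chosen representative; [unfoldE] gives independence of the choice. *)
Definition unfold u : real_mac R K :=
  to_real_mac (flip (parity (repr u).1) (set_val (repr u).2)).

(** The two parities differ only in coordinates where [y] vanishes, and there a sign change has no
    effect. *)
Lemma local_group_flip v w y : chamber R K y -> local_group y (v^-1 * w)%g ->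
  flip (parity v) y = flip (parity w) y.
Proof.
move=> Cy /(local_group_parity Cy) vw; apply/rowP => i; rewrite !flipE.
have := vw i; rewrite parityM parityV.
case: (i \in parity v); case: (i \in parity w) => //= /(_ isT);
by rewrite inE => /eqP ->; rewrite oppr0.
Qed.

Lemma unfoldE w x :
  set_val (unfold (basic_point w x)) = flip (parity w) (set_val x).
Proof.
rewrite /unfold; set p := repr _.
have /basic_pointP[px pw] : basic_point p.1 p.2 = basic_point w x.
  by rewrite /basic_point -surjective_pairing reprK.
rewrite to_setE; first by rewrite -px; apply: local_group_flip => //;
  exact: chamber_valP.
by apply: real_mac_flip; apply: chamber_real_mac; exact: chamber_valP.
Qed.

Lemma basic_ind (P : basic R K -> Prop) :
  (forall w x, P (basic_point w x)) -> forall u, P u.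
Proof.
by move=> Pwx u; rewrite -[u]reprK [repr u]surjective_pairing; exact: Pwx.
Qed.

Lemma cts_basic_point w (Y : topologicalType) (f : Y -> chamber R K) :
  continuous f -> continuous (fun t => basic_point w (f t)).
Proof.
move=> cf; have cp : continuous (fun t => (w, f t) : prebasic R K).
  by apply: cts_pair; [exact: cts_cst|].
exact: (cts_comp (@pi_continuous (prebasic R K) _) cp).
Qed.

(** The group is discrete and [basic] carries the quotient topology, so continuity is tested on each
    chamber separately. *)
Lemma cts_from_basic (Y : topologicalType) (f : basic R K -> Y) :
  (forall w, continuous (fun x => f (basic_point w x))) -> continuous f.
Proof.
move=> cf; apply/quotient_continuous => -[w x] A nA.
have H : nbhs x (fun x' => A (f (basic_point w x'))) := cf w x A nA.
exists ([set w], fun x' => A (f (basic_point w x'))).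
  by split => //; exact: discrete_set1.
by move=> [w' x'] /= [-> ].
Qed.

Lemma open_basic (A : set (basic R K)) :
  (forall w x, A (basic_point w x) -> nbhs x (fun x' => A (basic_point w x')))
    ->
  open A.
Proof.
move=> HA; rewrite /open /= /quotient_open openE => -[w x] /= Awx.
exists ([set w], fun x' => A (basic_point w x')).
  by split; [exact: discrete_set1|exact: HA].
by move=> [w' x'] /= [-> ].
Qed.

Lemma cts_unfold : continuous unfold.
Proof.
apply: cts_from_basic => w.
rewrite (_ : (fun _ => _) = fun x => to_real_mac (flip (parity w) (set_val x))).
  apply: cts_to_set => [|x].
    by apply: cts_flip; apply: cts_set_val; exact: cts_id.
  by apply: real_mac_flip; apply: chamber_real_mac; exact: chamber_valP.
apply/funext => x; apply: set_val_inj; rewrite unfoldE to_setE//.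
by apply: real_mac_flip; apply: chamber_real_mac; exact: chamber_valP.
Qed.

Lemma cts_basic_act w : continuous (@basic_act R m K w).
Proof.
apply: cts_from_basic => v.
rewrite (_ : (fun _ => _) = basic_point (w * v)%g).
  by apply: cts_basic_point; exact: cts_id.
by apply/funext => x; rewrite basic_actE.
Qed.

Lemma unfold_act w u :
  set_val (unfold (basic_act w u)) = flip (parity w) (set_val (unfold u)).
Proof.
elim/basic_ind: u => v x; rewrite basic_actE !unfoldE; apply/rowP => i.
rewrite !flipE parityM; case: (i \in parity v); case: (i \in parity w) => //=.
by rewrite opprK.
Qed.

(** * Sheets over an open star *)

Section Sheet.
Context (y : 'rV[R]_m) (v : coxeter K).
Hypotheses (My : real_mac R K y) (vy : flip (parity v) (absr y) = y).

Let Cy : chamber R K (absr y) := chamber_absr My.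
Let zK : zeros (absr y) \in (K : {set {set 'I_m}}) :=
  zeros_simplex (chamber_real_mac Cy).

(** The open star of the lift of [y] in the chamber of [v]: the chambers around that lift form the
    left coset of [v] by the local group of [absr y]. *)
Definition unfold_sheet : set (basic R K) := [set u |
  star y (set_val (unfold u)) /\
  exists w x, u = basic_point w x /\ local_group (absr y) (v^-1 * w)%g].

Definition folded b : {set 'I_m} :=
  [set i | (y 0 i == 0) && (flip (parity v) (set_val b) 0 i < 0)]%SET.

(* Over a point of the star, the lift lies in the chamber obtained from that
   of v by crossing the mirrors through y that separate it from the point. *)
Definition unfold_section b : basic R K :=
  basic_point (v * word (word_of K (folded b)))%g (to_chamber (absr (set_val
    b))).

Lemma absr_zero (z : 'rV[R]_m) i : absr z 0 i = 0 <-> z 0 i = 0.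
Proof. by rewrite mxE; split=> [/eqP|->];
  rewrite ?normr0// normr_eq0 => /eqP. Qed.

Lemma zeros_absr (z : 'rV[R]_m) : zeros (absr z) = zeros z.
Proof. by apply/setP => i; rewrite !inE mxE normr_eq0. Qed.

Lemma star_local_group (z : 'rV[R]_m) g : star y z -> real_mac R K z ->
  local_group (absr z) g -> local_group (absr y) g.
Proof.
move=> yz Mz; apply: local_groupS => //; first exact: chamber_absr.
by move=> i /absr_zero zi; apply/absr_zero; exact: star_zero yz zi.
Qed.

Lemma absr_unfold w x : absr (set_val (unfold (basic_point w x))) = set_val x.
Proof.
rewrite unfoldE absr_flip absr_id// => i.
by apply: chamber_ge0; exact: chamber_valP.
Qed.

(** Another representative changes [w] by the local group of [x], which lies in that of [absr y]: a
    coordinate vanishing somewhere in the star vanishes at [y]. *)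
Lemma unfold_sheetP w x : unfold_sheet (basic_point w x) <->
  star y (flip (parity w) (set_val x)) /\ local_group (absr y) (v^-1 * w)%g.
Proof.
split=> [[yu [w' [x' [/esym E loc]]]]|[yu loc]]; last first.
  by split; [rewrite unfoldE|exists w, x].
split; first by rewrite -unfoldE.
have /basic_pointP[_ loc'] := E.
have [_ H _] := local_group_subgroup K (absr y).
have -> : (v^-1 * w = (v^-1 * w') * (w'^-1 * w))%g by rewrite mulgA mulgK.
apply: H => //; move: yu; rewrite -E => yu.
by apply: (star_local_group yu (real_mac_valP _)); rewrite absr_unfold.
Qed.

Lemma in_folded b i :
  (i \in folded b) = (y 0 i == 0) && (flip (parity v) (set_val b) 0 i < 0).
Proof. by rewrite inE. Qed.

Lemma folded_sub b : folded b \subset zeros (absr y).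
Proof.
by apply/fintype.subsetP => i; rewrite zeros_absr !inE => /andP[].
Qed.

Lemma parity_folded b : parity_word (word_of K (folded b)) = folded b.
Proof.
apply: parity_word_of; apply: fintype.subset_trans (folded_sub b) _.
exact: simplex_vertices.
Qed.

Lemma mem_folded b (i : vert K) :
  i \in word_of K (folded b) -> val i \in zeros (absr y).
Proof. by move=> /mem_word_of; exact: (fintype.subsetP (folded_sub b)). Qed.

Lemma vy_coord i : y 0 i = if i \in parity v then - `|y 0 i| else `|y 0 i|.
Proof. by rewrite -{1}vy flipE mxE. Qed.

Lemma unfold_sectionE b : star y (set_val b) -> unfold (unfold_section b) = b.
Proof.
move=> yb; apply: set_val_inj; rewrite unfoldE to_setE; last first.
  by apply: chamber_absr; exact: real_mac_valP.
apply/rowP => i; rewrite flipE parityM parity_wordE parity_folded mxE.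
have [b0 b1 _] := yb i; have := vy_coord i.
rewrite in_folded flipE; have [yi|yi|yi] := ltgtP (y 0 i) 0 => /=.
- have bi := b1 yi; rewrite (ltr0_norm bi) (ltr0_norm yi).
  by case: (i \in parity v) => /=; lra.
- have bi := b0 yi; rewrite (gtr0_norm bi) (gtr0_norm yi).
  by case: (i \in parity v) => /=; lra.
- move=> _; case: (i \in parity v) => /=.
    by rewrite oppr_lt0; case: ltrgt0P => //=; lra.
  by case: ltrgt0P => //=; lra.
Qed.

(** Words in the mirrors through [y] whose parities differ only where [b] vanishes define the same
    point. Both the inverse identity and the continuity of the section rest on this. *)
Lemma unfold_section_local (t : seq (vert K)) b :
  (forall i, i \in t -> val i \in zeros (absr y)) ->
  (forall k, k \in parity_word t -> k \notin folded b -> set_val b 0 k = 0) ->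
  (forall k, k \in folded b -> k \notin parity_word t -> set_val b 0 k = 0) ->
  basic_point (v * word t)%g (to_chamber (absr (set_val b))) = unfold_section b.
Proof.
move=> ty t1 t2; apply/basic_pointP; split => //.
have Cb : chamber R K (absr (set_val b)) by apply: chamber_absr;
  exact: real_mac_valP.
rewrite to_setE// invgM -mulgA mulKg.
apply: (local_group_simplex Cb zK) => //; first exact: mem_folded.
- by move=> k; rewrite parity_folded zeros_absr in_zeros => k1 k2; apply/eqP;
  exact: t1.
- by move=> k; rewrite parity_folded zeros_absr in_zeros => k1 k2; apply/eqP;
  exact: t2.
Qed.

Lemma unfold_sectionK u : unfold_sheet u -> unfold_section (unfold u) = u.
Proof.
elim/basic_ind: u => w x /unfold_sheetP[yw /(local_groupP _ Cy)[t [ty tw]]].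
have Cx i : 0 <= set_val x 0 i by apply: chamber_ge0; exact: chamber_valP.
have E : basic_point w x =
    basic_point (v * word t)%g (to_chamber (absr (set_val (unfold (basic_point
      w x))))).
  by rewrite absr_unfold /to_chamber to_setK -tw mulVKg.
rewrite [RHS]E; apply/esym; apply: unfold_section_local => // k.
  move=> kt; have ky : k \in zeros y.
    by rewrite -zeros_absr; move: kt; rewrite inE => /odd_gt0;
      rewrite -has_count => /hasP[i /ty + /eqP <-].
  rewrite in_zeros in ky; rewrite in_folded ky unfoldE !flipE /=.
  have := parityM v (v^-1 * w)%g k;
    rewrite mulVKg tw parity_wordE kt addbT => ->.
  by have := Cx k; case: (k \in parity v) => /=; rewrite -leNgt; lra.
rewrite in_folded => /andP[ky]; rewrite unfoldE !flipE => kv kt.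
have := parityM v (v^-1 * w)%g k;
  rewrite mulVKg tw parity_wordE (negbTE kt) addbF => kvw.
by move: kv; rewrite kvw; have := Cx k; case: (k \in parity v) => /=; lra.
Qed.

Lemma unfold_section_sheet b : star y (set_val b) -> unfold_sheet
  (unfold_section b).
Proof.
move=> yb; split; first by rewrite unfold_sectionE.
exists (v * word (word_of K (folded b)))%g, (to_chamber (absr (set_val b))).
split => //; rewrite mulKg; apply/(local_groupP _ Cy).
by exists (word_of K (folded b)); split => // i; exact: mem_folded.
Qed.

Lemma open_unfold_sheet : open unfold_sheet.
Proof.
apply: open_basic => w x /unfold_sheetP[yw loc].
have H : nbhs x (fun x' => star y (flip (parity w) (set_val x'))).
  have c : continuous (fun x' => flip (parity w) (set_val x') : 'rV[R]_m).
    by apply: cts_flip; apply: cts_set_val; exact: cts_id.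
  by apply: c; apply: open_nbhs_nbhs; split; [exact: open_star|].
by apply: filterS H => x' yx'; apply/unfold_sheetP.
Qed.

Lemma cts_unfold_section b0 : star y (set_val b0) ->
  {for b0, continuous unfold_section}.
Proof.
move=> yb0 A nA.
(* [folded] may jump, but it takes finitely many values [J], and each branch [f J] is continuous. *)
pose f J b := basic_point (v * word (word_of K J))%g (to_chamber (absr (set_val
  b))).
have cf J : continuous (f J).
  apply: cts_basic_point; apply: cts_to_set => [|b].
    by apply: cts_absr; apply: cts_set_val; exact: cts_id.
  by apply: chamber_absr; exact: real_mac_valP.
have H1 : nbhs b0 (fun b => forall J, f J b0 = unfold_section b0 -> A (f J b)).
  apply: (@filter_forall _ _ (fun J b => f J b0 = unfold_section b0 -> A (f J
    b))
    _ (nbhs_filter b0)) => J.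
  have [E|N] := pselect (f J b0 = unfold_section b0).
    rewrite -E in nA; have H : nbhs b0 (fun b => A (f J b)) := cf J b0 A nA.
    by apply: filterS H => b.
  by apply: filterS filterT => b _ /N.
have H2 : nbhs b0 (fun b => star (set_val b0) (set_val b)).
  apply: (@initial_continuous _ _ set_val b0 (star (set_val b0))).
  by apply: open_nbhs_nbhs; split; [exact: open_star|exact: star_refl].
suff : nbhs b0 (fun b => A (unfold_section b)) by [].
apply: filterS2 H1 H2 => b /(_ (folded b)) + b0b; apply.
(* Near [b0] the folded set differs from that of [b0] only where [b0] vanishes, so every branch that
   occurs has the value of the section at [b0]. *)
apply: unfold_section_local; rewrite ?parity_folded; first exact: mem_folded.
- move=> k; rewrite !in_folded => /andP[-> bk] /=; rewrite -leNgt => b0k.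
  have [h1 h2 _] := star_flip (parity v) b0b k.
  have : flip (parity v) (set_val b0) 0 k = 0.
    by apply/eqP; rewrite eq_le b0k andbT leNgt; apply/negP => /h1; lra.
  by rewrite flipE; case: ifP => // _; lra.
- move=> k; rewrite !in_folded => /andP[-> bk] /=; rewrite -leNgt => b0k.
  by have [h1 h2 _] := star_flip (parity v) b0b k; have := h2 bk; lra.
Qed.

End Sheet.

Lemma sheet_unfold y v : real_mac R K y -> flip (parity v) (absr y) = y ->
  sheet unfold (set_val @^-1` star y) (unfold_sheet y v) (unfold_section y v).
Proof.
move=> My vy; split.
- exact: open_unfold_sheet.
- by move=> u [].
- by move=> b yb; exact: cts_unfold_section.
- by move=> b yb; split; [exact: unfold_section_sheet|exact: unfold_sectionE].
- by move=> u; exact: unfold_sectionK.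
Qed.

Lemma star_unfold_flip y w x : star y (flip (parity w) (set_val x)) ->
  flip (parity w) (absr y) = y.
Proof.
move=> yw; apply/rowP => i; have [h1 h2 _] := yw i; move: h1 h2.
rewrite !flipE mxE; have := chamber_ge0 i (chamber_valP x).
by case: (i \in parity w); case: ltrgt0P => //; lra.
Qed.

Lemma covering_unfold : covering_map unfold.
Proof.
split=> [|b]; first exact: cts_unfold.
set y := set_val b; have My : real_mac R K y by exact: real_mac_valP.
exists (set_val @^-1` star y); split.
- move: (@initial_continuous _ _ (set_val : real_mac R K -> _)) =>
  /continuousP; apply.
  exact: open_star.
- exact: star_refl.
exists [set unfold_sheet y v | v in [set v | flip (parity v) (absr y) = y]].
split.
(* A common point puts [v] and [v'] in one coset of the local group, so the sheets coincide. *)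
- move=> _ _ [v vy <-] [v' vy' <-] [u [uv uv']].
  move: uv uv'; elim/basic_ind: u => w x.
  move=> /(unfold_sheetP _ My)[_ l1] /(unfold_sheetP _ My)[_ l2].
  have [_ HM HV] := local_group_subgroup K (absr y).
  have l12 : local_group (absr y) (v^-1 * v')%g.
    by have := HM _ _ l1 (HV _ l2); rewrite invgM invgK mulgA mulgK.
  apply/seteqP; split; elim/basic_ind => w' x' /(unfold_sheetP _ My)[s l];
    apply/(unfold_sheetP _ My); split => //.
  + by have := HM _ _ (HV _ l12) l; rewrite invgM invgK mulgA mulgK.
  + by have := HM _ _ l12 l; rewrite mulgA mulgK.
- apply/seteqP; split=> [|u [_ [v vy <-]] []//].
  elim/basic_ind => w x /=; rewrite unfoldE => yw.
  exists (unfold_sheet y w); first by exists w => //;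
    exact: star_unfold_flip yw.
  apply/(unfold_sheetP _ My); split => //; rewrite mulVg.
  by have [] := local_group_subgroup K (absr y).
- move=> _ [v vy <-]; have [oV VU cs sV sK] := sheet_unfold My vy; split => //.
  exists (unfold_section y v); split.
  + by apply: continuous_in_subspaceT => c /set_mem; exact: cs.
  + by move=> c /sV[].
  + by move=> c /set_mem /sV[].
  + by move=> u /set_mem /sK.
Qed.

End Unfolding.

(** * Simple connectedness of the basic construction *)

Section SimplyConnected.
Context (R : realType) (m : nat) (K : scomplex m).
Implicit Types (v w : coxeter K) (x : chamber R K) (i j : vert K).
Implicit Types (s t : seq (vert K)) (u : basic R K) (g h : R -> basic R K).

Definition aligned x x' := forall r, 0 <= r <= 1 ->
  chamber R K (segment (set_val x) (set_val x') r).

Lemma aligned_sym x x' : aligned x x' -> aligned x' x.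
Proof.
move=> a r r01; have := a (1 - r); rewrite (_ : segment _ _ _ =
  segment (set_val x') (set_val x) r); first by apply; lra.
by apply/rowP => k; rewrite !mxE; lra.
Qed.

Lemma aligned_le x x' : (forall k, set_val x 0 k = 1 -> set_val x' 0 k = 1) ->
  aligned x x'.
Proof. by move=> xx' r; apply: chamber_segment => //; exact: chamber_valP. Qed.

Lemma aligned_corner x : aligned (chamber_corner_pt R K) x.
Proof. by apply/aligned_sym/aligned_le => k _; rewrite /= mxE. Qed.

Definition seg w x x' : R -> basic R K := fun r =>
  basic_point w (to_chamber K (segment (set_val x) (set_val x') (clamp r))).

Local Notation ray w x := (seg w (chamber_corner_pt R K) x).

Lemma seg0 w x x' : seg w x x' 0 = basic_point w x.
Proof. by rewrite /seg clamp0 segment0 /to_chamber to_setK. Qed.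

Lemma seg1 w x x' : seg w x x' 1 = basic_point w x'.
Proof. by rewrite /seg clamp1 segment1 /to_chamber to_setK. Qed.

Lemma cts_seg w x x' : aligned x x' -> continuous (seg w x x').
Proof.
move=> a; apply: cts_basic_point; apply: cts_to_set => [|r].
  by apply: cts_segment; cts.
by apply: a; rewrite clamp_ge0 clamp_le1.
Qed.

Lemma cts_ray w x : continuous (ray w x).
Proof. by apply: cts_seg; exact: aligned_corner. Qed.

Lemma seg_rev w x x' : eq01 (path_rev (seg w x x')) (seg w x' x).
Proof.
move=> r r01; rewrite /path_rev /seg !clampE//; last by lra.
by congr (basic_point w (to_chamber K _)); apply/rowP => k; rewrite !mxE; lra.
Qed.

(** The cone from the corner over the segment lies in the chamber; two sides of this triangle are
    homotopic to the third inside it. *)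
Lemma ray_seg w x x' : aligned x x' ->
  path_homotopic (path_cat (ray w x) (seg w x x')) (ray w x').
Proof.
move=> a.
(* The square is mapped onto the triangle: [1 - clamp p.1], [clamp p.1 - b p] and [b p] are the
   barycentric coordinates for the corner, [x] and [x']. *)
pose b (p : R * R) := Num.min (clamp p.2) (clamp p.1).
pose f p : 'rV[R]_m := \row_k ((1 - clamp p.1) * 1 +
  ((clamp p.1 - b p) * set_val x 0 k + b p * set_val x' 0 k)).
have Cf p : chamber R K (f p).
  have a0 : 0 <= clamp p.1 <= 1 by rewrite clamp_ge0 clamp_le1.
  have ba : 0 <= b p <= clamp p.1.
    by rewrite /b le_min !clamp_ge0 /= ge_min lexx orbT.
  have [e|n] := eqVneq (clamp p.1) 0.
    have b0 : b p = 0 by lra.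
    rewrite (_ : f p = corner R m); first exact: chamber_corner.
    by apply/rowP => k; rewrite !mxE e b0; lra.
  pose r := b p / clamp p.1.
  have r01 : 0 <= r <= 1.
    have a_gt0 : 0 < clamp p.1 by rewrite lt_neqAle eq_sym n clamp_ge0.
    by rewrite /r ler_pdivrMr// mul1r divr_ge0//; lra.
  have rb : r * clamp p.1 = b p by rewrite /r divfK.
  have Ca := a r r01.
  have := @aligned_corner (to_chamber K (segment (set_val x) (set_val x') r)).
  rewrite /aligned /to_chamber to_setE// => /(_ _ a0).
  rewrite (_ : segment _ _ (clamp p.1) = f p)//.
  by apply/rowP => k; rewrite !mxE -rb; ring.
pose F p := basic_point w (to_chamber K (f p)).
have cF : continuous F.
  apply: cts_basic_point; apply: cts_to_set => //; apply: cts_row => k.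
  rewrite (_ : (fun _ => _) = fun p => (1 - clamp p.1) * 1 +
    ((clamp p.1 - b p) * set_val x 0 k + b p * set_val x' 0 k)).
    by rewrite /b; cts.
  by apply/funext => p; rewrite mxE.
(* The bottom and right sides of the square give the ray and the segment, the diagonal gives the ray
   to [x']. *)
have := @path_homotopic_plane _ _ F (path_cat (fun r => (r, 0)) (fun r => (1,
  r)))
  (fun r => (r, r)) cF.
rewrite (path_cat_comp F) => H; apply: path_homotopic_eq01 (H _ _ _ _).
- apply: eq01_cat => r r01; rewrite /F /seg /=;
    congr (basic_point w (to_chamber K _)); apply/rowP => k; rewrite !mxE /b /=.
  + by rewrite clamp0 (min_idPl (clamp_ge0 _)); lra.
  + by rewrite clamp1 (min_idPl (clamp_le1 _)); lra.
- move=> r r01; rewrite /F /seg /=.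
  congr (basic_point w (to_chamber K _)); apply/rowP => k; rewrite !mxE /b /=.
  by rewrite minxx; lra.
- by apply: cts_path_cat; [by cts|by cts|].
- by cts.
- by rewrite path_cat0.
- by rewrite path_cat1.
Qed.

Definition center (J : {set 'I_m}) : chamber R K :=
  to_chamber K (face_center R J).

Lemma centerE (J : {set 'I_m}) k : J \in (K : {set {set 'I_m}}) ->
  set_val (center J) 0 k = (k \notin J)%:R.
Proof.
by move=> JK; rewrite /center to_setE ?mxE//; exact: chamber_face_center.
Qed.

Lemma vert_simplex i : [set val i]%SET \in (K : {set {set 'I_m}}).
Proof. by have := valP i; rewrite inE. Qed.

(* The path through the chambers of the prefixes of a word, crossing the
   successive mirrors at their centers; [r] lists the word backwards. *)
Fixpoint rev_word_path (r : seq (vert K)) : R -> basic R K :=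
  match r with
  | [::] => fun _ => basic_point (word [::]) (chamber_corner_pt R K)
  | i :: r' => path_cat (path_cat (rev_word_path r')
      (ray (word (rev r')) (center [set val i]%SET)))
      (path_rev (ray (word (rev r)) (center [set val i]%SET)))
  end.

Definition word_path s := rev_word_path (rev s).

Definition point_path s x := path_cat (word_path s) (ray (word s) x).

Lemma word_path_rcons s i : word_path (rcons s i) =
  path_cat (point_path s (center [set val i]%SET))
           (path_rev (ray (word (rcons s i)) (center [set val i]%SET))).
Proof. by rewrite /word_path rev_rcons /= rev_cons !revK. Qed.

Lemma mirror_point s i x : set_val x 0 (val i) = 0 ->
  basic_point (word (rcons s i)) x = basic_point (word s) x.
Proof.
move=> xi; apply/basic_pointP; split => //; apply/local_groupP;
  first exact: chamber_valP.
exists [:: i]; split=> [j|].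
  by rewrite mem_seq1 => /eqP ->; rewrite in_zeros xi.
rewrite wordV wordM rev_rcons; apply/wordP.
exact: CoxCat (CoxRefl [:: i]) (coxeter_eq_rev s).
Qed.

Lemma center_mirror i : set_val (center [set val i]%SET) 0 (val i) = 0.
Proof. by rewrite centerE ?vert_simplex// inE eqxx. Qed.

Lemma word_path_ends s : [/\ continuous (word_path s),
  word_path s 0 = basic_point (word [::]) (chamber_corner_pt R K)
  & word_path s 1 = basic_point (word s) (chamber_corner_pt R K)].
Proof.
elim/last_ind: s => [|s i [c0 p0 p1]]; first by split => //; exact: cts_cst.
rewrite word_path_rcons; split.
- apply: cts_path_cat.
  + by apply: cts_path_cat => //; [exact: cts_ray|rewrite seg0].
  + by apply: cts_path_rev; exact: cts_ray.
  + by rewrite /point_path path_cat1 path_rev0 !seg1 mirror_point//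
    center_mirror.
- by rewrite /point_path !path_cat0.
- by rewrite path_cat1 path_rev1 seg0.
Qed.

Lemma cts_word_path s : continuous (word_path s).
Proof. by have [] := word_path_ends s. Qed.

Lemma word_path_ray s x : word_path s 1 = ray (word s) x 0.
Proof. by have [_ _ ->] := word_path_ends s; rewrite seg0. Qed.

Lemma cts_point_path s x : continuous (point_path s x).
Proof. by apply: cts_path_cat;
  [exact: cts_word_path|exact: cts_ray|exact: word_path_ray]. Qed.

Lemma point_path0 s x :
  point_path s x 0 = basic_point (word [::]) (chamber_corner_pt R K).
Proof. by rewrite /point_path path_cat0; have [] := word_path_ends s. Qed.

Lemma point_path1 s x : point_path s x 1 = basic_point (word s) x.
Proof. by rewrite /point_path path_cat1 seg1. Qed.

Lemma point_path_seg s x x' : aligned x x' ->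
  path_homotopic (path_cat (point_path s x) (seg (word s) x x')) (point_path s
    x').
Proof.
move=> a; apply: path_homotopic_trans (path_catA _ _ _ _ _) _.
- exact: cts_word_path.
- exact: cts_ray.
- exact: cts_seg.
- exact: word_path_ray.
- by rewrite seg0 seg1.
apply: path_cat_congrr; last exact: ray_seg.
- by rewrite path_cat0; exact: word_path_ray.
- exact: cts_word_path.
Qed.

(** Crossing the mirror at its centre and coming back cancels, and the segment from the centre to
    [x] stays in the mirror, where the two chambers are identified. *)
Lemma point_path_mirror s i x : set_val x 0 (val i) = 0 ->
  path_homotopic (point_path (rcons s i) x) (point_path s x).
Proof.
move=> xi; set c := center [set val i]%SET.
have ac : aligned c x.
  apply/aligned_sym/aligned_le => k xk; rewrite centerE ?vert_simplex// inE.
  by case: eqP => // ki; move: xk; rewrite ki xi => /eqP;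
    rewrite eq_sym oner_eq0.
have crosses : path_homotopic (point_path (rcons s i) c) (point_path s c).
  rewrite /point_path word_path_rcons; apply: path_catVK.
  - exact: cts_point_path.
  - exact: cts_ray.
  - by rewrite point_path1 seg1 mirror_point// center_mirror.
have same_seg : seg (word (rcons s i)) c x = seg (word s) c x.
  apply/funext => r; rewrite /seg mirror_point// to_setE; last first.
    by apply: ac; rewrite clamp_ge0 clamp_le1.
  by rewrite mxE xi centerE ?vert_simplex// inE eqxx !mulr0 addr0.
apply: path_homotopic_trans (path_homotopic_sym (point_path_seg _ ac)) _.
rewrite same_seg; apply: path_homotopic_trans (point_path_seg s ac).
apply: path_cat_congrl => //; last exact: cts_seg.
by rewrite point_path1 seg0 mirror_point// center_mirror.
Qed.

Lemma point_path_mirrors s t x : (forall i,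
  i \in t -> set_val x 0 (val i) = 0) ->
  path_homotopic (point_path (s ++ t) x) (point_path s x).
Proof.
elim/last_ind: t => [|t i IH] tx.
  by rewrite cats0; apply: path_homotopic_refl; exact: cts_point_path.
rewrite -rcons_cat; apply: path_homotopic_trans (point_path_mirror _ _) _.
  by apply: tx; rewrite mem_rcons inE eqxx.
by apply: IH => j jt; apply: tx; rewrite mem_rcons inE jt orbT.
Qed.

(** Following the path to [x] by the reversed ray recovers the path to the corner. *)
Lemma word_path_of_point_path s t x : word s = word t ->
  path_homotopic (point_path s x) (point_path t x) ->
  path_homotopic (word_path s) (word_path t).
Proof.
move=> st pst.
have K' r : word r = word t -> path_homotopic
    (path_cat (point_path r x) (path_rev (ray (word t) x))) (word_path r).
  move=> <-; apply: path_catK; [exact: cts_word_path|exact: cts_ray|].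
  exact: word_path_ray.
apply: path_homotopic_trans (path_homotopic_sym (K' _ st)) _.
apply: path_homotopic_trans (K' _ erefl).
apply: path_cat_congrl => //.
  by rewrite point_path1 path_rev0 seg1 st.
by apply: cts_path_rev; exact: cts_ray.
Qed.

Lemma point_path_congr s t x : word s = word t ->
  path_homotopic (word_path s) (word_path t) ->
  path_homotopic (point_path s x) (point_path t x).
Proof.
move=> st pst; rewrite /point_path -st; apply: path_cat_congrl => //.
- exact: word_path_ray.
- exact: cts_ray.
Qed.

Lemma word_path_cat s t r : word s = word t ->
  path_homotopic (word_path s) (word_path t) ->
  path_homotopic (word_path (s ++ r)) (word_path (t ++ r)).
Proof.
move=> st pst; elim/last_ind: r => [|r i IH]; first by rewrite !cats0.
have w r' : word (s ++ r') = word (t ++ r') by rewrite -!wordM st.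
rewrite -!rcons_cat !word_path_rcons !rcons_cat w; apply: path_cat_congrl.
- by rewrite point_path1 path_rev0 seg1 w -rcons_cat mirror_point//
  center_mirror.
- by apply: cts_path_rev; exact: cts_ray.
- exact: point_path_congr.
Qed.

(** At the centre of [J] the mirrors of all letters of [t] meet, so these letters are dropped one by
    one; as [t] is trivial, both paths return to the corner along the same ray. *)
Lemma word_path_mirrors s t (J : {set 'I_m}) : J \in (K : {set {set 'I_m}}) ->
  (forall i, i \in t -> val i \in J) -> word t = 1%g ->
  path_homotopic (word_path (s ++ t)) (word_path s).
Proof.
move=> JK tJ t1; apply: (@word_path_of_point_path _ _ (center J)).
  by rewrite -wordM t1 mulg1.
by apply: point_path_mirrors => i /tJ iJ; rewrite centerE// iJ.
Qed.

(* Two words for the same group element give homotopic paths: the squares and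
   commutations of the presentation are homotopies through the centers of
   the mirrors and of their intersections. *)
Lemma word_path_coxeter s t : coxeter_eq s t ->
  path_homotopic (word_path s) (word_path t).
Proof.
(* An arbitrary context on both sides lets the induction pass through concatenation. *)
move=> st; suff : forall p r,
    path_homotopic (word_path (p ++ s ++ r)) (word_path (p ++ t ++ r)).
  by move=> /(_ [::] [::]); rewrite !cats0.
elim: st => {s t}.
- by move=> s p r; apply: path_homotopic_refl; exact: cts_word_path.
- by move=> s t _ IH p r; apply: path_homotopic_sym.
- by move=> s t u _ IH1 _ IH2 p r;
  apply: path_homotopic_trans (IH1 p r) (IH2 p r).
- move=> s t u v _ IH1 _ IH2 p r; rewrite -!catA.
  apply: path_homotopic_trans (IH1 p (u ++ r)) _.
  by rewrite !(catA p t); exact: IH2.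
- move=> i p r; rewrite !(catA p); apply: word_path_cat.
    by rewrite cats0 -wordM -[RHS]mulg1; congr (_ * _)%g; apply/wordP/CoxSquare.
  rewrite cats0; apply: (word_path_mirrors _ (vert_simplex i)).
    by move=> j; rewrite !inE orbb.
  exact/wordP/CoxSquare.
- move=> i j ij p r; rewrite !(catA p); apply: word_path_cat.
    by rewrite cats0 -wordM -[RHS]mulg1; congr (_ * _)%g; apply/wordP/CoxComm.
  rewrite cats0; apply: (word_path_mirrors _ ij).
    by move=> k; rewrite !inE => /or4P[] /eqP ->; rewrite eqxx ?orbT.
  exact/wordP/CoxComm.
Qed.

(** Up to equality in the group, the words differ by letters whose mirrors contain the point:
    [point_path_mirrors] absorbs the letters and [word_path_coxeter] treats the equality. *)
Lemma point_path_unique s t x x' :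
  basic_point (word s) x = basic_point (word t) x' ->
  path_homotopic (point_path s x) (point_path t x').
Proof.
move=> /basic_pointP[<- /(local_groupP _ (chamber_valP x))[r [rx str]]].
have wst : word (s ++ r) = word t by rewrite -wordM -str mulVKg.
apply: (@path_homotopic_trans _ _ (point_path (s ++ r) x)).
  apply/path_homotopic_sym/point_path_mirrors => i /rx.
  by rewrite in_zeros => /eqP.
by apply: point_path_congr => //; apply: word_path_coxeter; exact/wordP.
Qed.

(** Only one representative of [u] is asked for; [canonicalP] passes to any other. *)
Definition canonical g u := exists s x,
  u = basic_point (word s) x /\ path_homotopic g (point_path s x).

Lemma canonicalP g s x : canonical g (basic_point (word s) x) ->
  path_homotopic g (point_path s x).
Proof.
move=> [t [x' [e gt]]]; apply: path_homotopic_trans gt _.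
exact: point_path_unique.
Qed.

Lemma canonical_congr g h u : path_homotopic g h -> canonical g u -> canonical
  h u.
Proof.
move=> gh [s [x [-> gs]]]; exists s, x; split => //.
exact: path_homotopic_trans (path_homotopic_sym gh) gs.
Qed.

Lemma canonical1 g u : canonical g u -> g 1 = u.
Proof. by move=> [s [x [-> /path_homotopic1 ->]]]; rewrite point_path1. Qed.

Lemma canonical_seg g w x x' : aligned x x' -> continuous g ->
  canonical g (basic_point w x) ->
  canonical (path_cat g (seg w x x')) (basic_point w x').
Proof.
move=> a cg; elim/coxeter_ind: w => s cgs; exists s, x'; split => //.
apply: path_homotopic_trans (point_path_seg s a).
apply: path_cat_congrl; [by rewrite (canonical1 cgs) seg0|exact: cts_seg|].
exact: canonicalP.
Qed.

Lemma canonical_exists u : exists g, [/\ continuous g,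
  g 0 = basic_point (word [::]) (chamber_corner_pt R K) & canonical g u].
Proof.
elim/basic_ind: u => w x; elim/coxeter_ind: w => s; exists (point_path s x);
  split.
- exact: cts_point_path.
- exact: point_path0.
- by exists s, x; split => //; apply: path_homotopic_refl;
  exact: cts_point_path.
Qed.

Lemma path_connected_basic : path_connected R (basic R K).
Proof.
move=> u u'; have [g [cg g0 /canonical1 g1]] := canonical_exists u.
have [h [ch h0 /canonical1 h1]] := canonical_exists u'.
exists (path_cat (path_rev g) h).
rewrite path_cat0 path_cat1 path_rev0; split => //.
apply: continuous_subspaceT; apply: cts_path_cat => //;
  first exact: cts_path_rev.
by rewrite path_rev1 g0.
Qed.

(* Near a point z the path can be pushed to z inside the star of z; both the
   left and the right sides of the resulting square lie in one chamber. *)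
Lemma canonical_near h r0 : continuous h -> exists2 d, 0 < d &
  forall a b, a <= b -> r0 - d < a -> b < r0 + d ->
  forall g, continuous g -> canonical g (h a) ->
  canonical (path_cat g (subpath h a b)) (h b).
Proof.
move=> ch; pose y := set_val (unfold (h r0)).
have My : real_mac R K y by exact: real_mac_valP.
have [v [x0 hr0]] : exists v x0, h r0 = basic_point v x0.
  by elim/basic_ind: (h r0) => v x; exists v, x.
have yE : y = flip (parity v) (set_val x0) by rewrite /y hr0 unfoldE.
have ax0 : absr y = set_val x0 by rewrite /y hr0 absr_unfold.
have vy : flip (parity v) (absr y) = y by rewrite ax0 yE.
have [oV VU cs sV sK] := sheet_unfold My vy.
have Vr0 : unfold_sheet y v (h r0).
  rewrite hr0; apply/unfold_sheetP => //; split; first by rewrite -yE.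
  by rewrite mulVg; have [] := local_group_subgroup K (absr y).
have : nbhs r0 (fun r => unfold_sheet y v (h r)) by apply: ch;
  exact: open_nbhs_nbhs.
move=> /(nbhs_ballP _ _).1[d /= d0 dV]; exists d => // a b ab ra rb g cg ga.
have Vab r : 0 <= r <= 1 -> unfold_sheet y v (h ((1 - r) * a + r * b)).
  by move=> /andP[? ?]; apply: dV; rewrite /ball /= ltr_norml; nra.
(* The first coordinate is time along [h] from [a] to [b], the second pushes straight towards
   [y]. *)
pose pt (p : R * R) := segment
  (set_val (unfold (h ((1 - clamp p.1) * a + clamp p.1 * b)))) y (clamp p.2).
have star_pt p : star y (pt p).
  apply: star_segment; last by rewrite clamp_ge0 clamp_le1.
  by apply: VU; apply: Vab; rewrite clamp_ge0 clamp_le1.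
have Mpt p : real_mac R K (pt p).
  apply: real_mac_segment => //; first exact: real_mac_valP.
    move=> i i1; apply: star_norm1 i1; last exact: (real_mac_norm i My).
    by apply: VU; apply: Vab; rewrite clamp_ge0 clamp_le1.
  by rewrite clamp_ge0 clamp_le1.
have cpt : continuous pt.
  apply: cts_segment; [|by cts|by cts].
  apply: cts_set_val; apply: (cts_comp (@cts_unfold R m K)).
  by apply: (cts_comp ch); cts.
pose F p := unfold_section y v (to_real_mac K (pt p)).
have cF : continuous F.
  move=> p; apply: (@cts_at_comp _ _ _ (unfold_section y v)
                      (fun p => to_real_mac K (pt p))).
    by apply: cts_to_set.
  by apply: cs; rewrite /= to_setE.
have F0 : eq01 (fun r => F (r, 0)) (subpath h a b).
  move=> r r01; rewrite /F /pt /= clamp0 segment0 clampE//.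
  by rewrite /to_real_mac to_setK sK//; exact: Vab.
have F1 r : F (r, 1) = h r0.
  by rewrite /F /pt /= clamp1 segment1 /to_real_mac to_setK sK.
(* On a vertical side the lifted square runs straight inside one chamber, from a point of [h] to
   [h r0]. *)
have side e : 0 <= e <= 1 -> exists w x, [/\ aligned x x0,
    h ((1 - e) * a + e * b) = basic_point w x,
    basic_point w x0 = h r0 & forall r, F (e, r) = seg w x x0 r].
  move=> e01; have := Vab e e01.
  case: (basic_ind (P := fun u => exists w x, u = basic_point w x) _
    (h ((1 - e) * a + e * b))) => [w x|w [x hx]]; first by exists w, x.
  rewrite hx => /(unfold_sheetP _ My)[yw loc].
  have ax : aligned x x0.
    apply: aligned_le => i xi; have := star_norm1 yw (real_mac_norm i My).
    rewrite flipE xi yE flipE; have := chamber_ge0 i (chamber_valP x0).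
    case: (i \in parity w); case: (i \in parity v);
      rewrite ?normrN normr1 => ? /(_ erefl);
    lra.
  have wx0 : basic_point w x0 = h r0.
    rewrite hr0; apply/esym/basic_pointP; split => //; by rewrite -ax0.
  exists w, x; split => // r; rewrite /F /pt /= (clampE e01) hx.
  have yw' : y = flip (parity w) (set_val x0) by rewrite /y -wx0 unfoldE.
  rewrite unfoldE {2}yw' segment_flip.
  set x' := to_chamber K (segment (set_val x) (set_val x0) (clamp r)).
  have Cx' : chamber R K (segment (set_val x) (set_val x0) (clamp r)).
    by apply: ax; rewrite clamp_ge0 clamp_le1.
  have -> : to_real_mac K (flip (parity w) (segment (set_val x) (set_val x0)
    (clamp r)))
      = unfold (basic_point w x').
    apply: set_val_inj; rewrite unfoldE !to_setE//.
    by apply: real_mac_flip; exact: chamber_real_mac.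
  rewrite sK//; apply/unfold_sheetP => //; split => //.
  rewrite to_setE// -segment_flip -yw'.
  by apply: star_segment => //; rewrite clamp_ge0 clamp_le1.
have [w0 [x1 [a1 ha w0x0 F0r]]] := side 0 ltac:(by rewrite lexx ler01).
have [w1 [x2 [a2 hb w1x0 F1r]]] := side 1 ltac:(by rewrite lexx ler01).
have ea : (1 - 0) * a + 0 * b = a by lra.
have eb : (1 - 1) * a + 1 * b = b by lra.
rewrite ea in ha; rewrite eb in hb; rewrite ha in ga; rewrite hb.
have := path_homotopic_square cF.
rewrite (_ : (fun r => F (0, r)) = seg w0 x1 x0); last exact/funext.
rewrite (_ : (fun r => F (r, 1)) = (fun=> h r0)); last exact/funext.
rewrite (_ : (fun r => F (1, r)) = seg w1 x2 x0); last exact/funext.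
set L := seg w0 x1 x0; set T := seg w1 x2 x0 => sq.
have cL : continuous L by exact: cts_seg.
have cT : continuous T by exact: cts_seg.
have csub : continuous (subpath h a b) by exact: cts_subpath.
have sq1 : path_homotopic (path_cat L (path_rev T)) (subpath h a b).
  apply: path_homotopic_trans (path_homotopic_eq01 _ F0 sq); last first.
    by move=> r _.
  apply: path_cat_congrl; last 2 first.
  - exact: cts_path_rev.
  - apply: path_homotopic_sym; have := path_cat1r cL.
    by rewrite /L seg1 w0x0.
  by rewrite path_rev0 /L /T !seg1 w0x0 w1x0.
(* The class is carried to [h r0] in the chamber of [w0]; the same point, read in the chamber of
   [w1], then leads along a segment to [h b]. *)
have gL : canonical (path_cat g L) (basic_point w1 x0).
  by rewrite w1x0 -w0x0; exact: canonical_seg.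
have cgL : continuous (path_cat g L).
  by apply: cts_path_cat => //; rewrite (canonical1 ga) /L seg0.
have := canonical_seg (aligned_sym a2) cgL gL; apply: canonical_congr.
have gLe : g 1 = L 0 by rewrite (canonical1 ga) /L seg0.
have LT : L 1 = path_rev T 0 by rewrite path_rev0 /L /T !seg1 w0x0.
apply: (@path_homotopic_trans _ _ (path_cat (path_cat g L) (path_rev T))).
  apply: path_cat_congrr => //;
    first by rewrite path_cat1 /L seg1 seg0 w0x0 w1x0.
  apply/path_homotopic_sym/eq01_homotopic; first exact: cts_path_rev.
  exact: seg_rev.
apply: path_homotopic_trans (path_catA cg cL (cts_path_rev cT) gLe LT) _.
by apply: path_cat_congrr => //; rewrite path_cat0.
Qed.

Lemma canonical_subpath h a b : continuous h -> a <= b ->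
  forall g, continuous g -> canonical g (h a) ->
  canonical (path_cat g (subpath h a b)) (h b).
Proof.
move=> ch.
apply: (@cousin _ (fun a b => forall g, continuous g -> canonical g (h a) ->
  canonical (path_cat g (subpath h a b)) (h b))); last first.
  by move=> r; exact: canonical_near.
move=> x y z _ _ xy yz g cg gx.
have gx1 : g 1 = subpath h x y 0 by rewrite (canonical1 gx) subpath0.
have cxy := @cts_subpath _ _ h x y ch; have cyz := @cts_subpath _ _ h y z ch.
have xyz : subpath h x y 1 = subpath h y z 0 by rewrite subpath0 subpath1.
have := yz _ (cts_path_cat cg cxy gx1) (xy g cg gx); apply: canonical_congr.
apply: path_homotopic_trans (path_catA cg cxy cyz gx1 xyz) _.
apply: path_cat_congrr => //; first by rewrite path_cat0.
by apply: path_homotopic_sym; exact: subpath_cat.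
Qed.

Lemma simply_connected_basic : simply_connected R (basic R K).
Proof.
split; first by exists (basic_point (word [::]) (chamber_corner_pt R K)).
  exact: path_connected_basic.
move=> h0 ch0 h01; pose h r := h0 (clamp r).
have ch : continuous h.
  by apply: (within_cts ch0); [by cts|move=> r; exact: clamp_itv].
apply: (@null_homotopic_eq01 _ _ h) => [r r01|]; first by rewrite /h clampE.
have hl : h 0 = h 1 by rewrite /h clamp0 clamp1.
have [g [cg _ g0]] := canonical_exists (h 0).
(* Continued along the loop, the canonical path [g] is again canonical for the same point, so [g]
   followed by [h] is homotopic to [g]. *)
have := canonical_subpath ch (@ler01 R) cg g0; rewrite subpath01 -hl => gh.
apply/path_homotopic_null/(path_cat_fix_null cg ch); first exact: canonical1.
case: g0 => s [x [e gs]]; rewrite e in gh.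
exact: path_homotopic_trans (canonicalP gh) (path_homotopic_sym gs).
Qed.

Lemma universal_cover_unfold : universal_cover R (@unfold R m K).
Proof. by split; [exact: simply_connected_basic|exact: covering_unfold]. Qed.

End SimplyConnected.

(** * Comparison with an arbitrary universal cover *)

Section Assembly.
Context (R : realType).

Lemma covering_map_homeomorphism (E B B' : topologicalType) (q : E -> B)
    (k : B -> B') :
  covering_map q -> homeomorphism k -> covering_map (fun e => k (q e)).
Proof.
move=> [cq evq] [ck [k' [ck' kK k'K]]]; split; first exact: (cts_comp ck).
move=> b; have [U [oU Ub [F [tF UF FP]]]] := evq (k' b).
exists (k' @^-1` U); split => //; first by move/continuousP: ck'; apply.
exists F; split => //.
  by rewrite -UF; apply/seteqP; split=> e /=; rewrite kK.
move=> V FV; have [oV [s [cs fs qs sq]]] := FP V FV; split => //.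
exists (fun b => s (k' b)); split.
- apply: (@within_continuous_comp _ _ _ _ k' s);
  last exact: continuous_subspaceT.
  move=> _ /set_mem[c Uc <-].
  by move: cs; rewrite continuous_open_subspace//; apply; exact: mem_set.
- by move=> c Uc; exact: fs.
- by move=> c /set_mem Uc; rewrite qs ?k'K//; exact: mem_set.
- by move=> e Ve; rewrite kK sq.
Qed.

Context (m : nat) (K : scomplex m).

Definition flip_real_mac (J : {set 'I_m}) (b : real_mac R K) : real_mac R K :=
  to_real_mac K (flip J (set_val b)).

Lemma flip_real_macE J b : set_val (flip_real_mac J b) = flip J (set_val b).
Proof. by rewrite to_setE//; apply: real_mac_flip; exact: real_mac_valP. Qed.

Lemma homeomorphism_flip_real_mac J : homeomorphism (flip_real_mac J).
Proof.
have cJ : continuous (flip_real_mac J).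
  apply: cts_to_set => [|b]; last by apply: real_mac_flip; exact: real_mac_valP.
  by apply: cts_flip; apply: cts_set_val; exact: cts_id.
have JK : cancel (flip_real_mac J) (flip_real_mac J).
  by move=> b; apply: set_val_inj; rewrite !flip_real_macE flipK.
by split => //; exists (flip_real_mac J).
Qed.

Lemma parity_cox_gen (i : vert K) : parity (cox_gen i) = [set val i]%SET.
Proof.
rewrite parity_wordE; apply/setP => k.
by rewrite !inE /= addn0 oddb eq_sym.
Qed.

(* Coordinates outside the vertex set are constantly 1 or -1 on a component:
   flipping them reaches every component from that of the chamber. *)
Lemma unfold_flip_onto (b : real_mac R K) : exists (J : {set 'I_m}) (u : basic
  R K),
  flip_real_mac J (unfold u) = b.
Proof.
pose N := [set i | set_val b 0 i < 0]%SET.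
pose u := basic_point (word (word_of K (N :&: vertices K)%SET))
  (to_chamber K (absr (set_val b))).
exists (N :\: vertices K)%SET, u.
apply: set_val_inj; rewrite flip_real_macE unfoldE to_setE; last first.
  by apply: chamber_absr; exact: real_mac_valP.
rewrite parity_wordE parity_word_of ?finset.subsetIr//.
apply/rowP => i; rewrite !flipE !inE mxE.
by case: ([set i]%SET \in _); case: ltrgt0P => //=; lra.
Qed.

Lemma basic_act1 (u : basic R K) : basic_act 1%g u = u.
Proof. by elim/basic_ind: u => w x; rewrite basic_actE mul1g. Qed.

Lemma basic_actM (v w : coxeter K) (u : basic R K) :
  basic_act (v * w)%g u = basic_act v (basic_act w u).
Proof. by elim/basic_ind: u => z x; rewrite !basic_actE mulgA. Qed.

(** The corner lies on no mirror, so its local group is trivial. *)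
Lemma basic_corner_inj (v w : coxeter K) :
  basic_point v (chamber_corner_pt R K) = basic_point w (chamber_corner_pt R K)
    ->
  v = w.
Proof.
move=> /basic_pointP[_ /(local_groupP _ (chamber_corner R K))[[|i s] [sP vw]]].
  by apply: (@mulgI _ v^-1%g); rewrite mulVg vw.
by have := sP i; rewrite inE eqxx in_zeros mxE oner_eq0 => /(_ isT).
Qed.

Lemma unfold_flip_corner (J : {set 'I_m}) (u : basic R K) :
  set_val (unfold u) = flip J (corner R m) ->
  exists2 w, u = basic_point w (chamber_corner_pt R K) & parity w = J.
Proof.
elim/basic_ind: u => w x; rewrite unfoldE => wJ.
have xc : set_val x = corner R m.
  apply/rowP => i; move/rowP/(_ i): wJ; have := chamber_ge0 i (chamber_valP x).
  by rewrite !flipE !mxE; case: ifP; case: ifP; lra.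
exists w.
  by congr basic_point; apply: set_val_inj; rewrite xc.
apply/setP => i; move/rowP/(_ i): wJ; rewrite xc !flipE mxE.
by case: (i \in parity w); case: (i \in J) => //; lra.
Qed.

(** Read through [h], a lift of [flip J] sends the corner of the identity chamber over a reflected
    corner, hence to the corner of a unique chamber [w], of parity [J]. Lifts that agree at one
    point are equal. *)
Lemma reflection_lift_action_transport (E : topologicalType)
    (q : E -> real_mac R K) (J0 : {set 'I_m}) (h : basic R K -> E) (h' : E ->
      basic R K) :
  universal_cover R q -> continuous h -> continuous h' ->
  cancel h h' -> cancel h' h ->
  (forall u, q (h u) = flip_real_mac J0 (unfold u)) ->
  reflection_lift_action q (fun w e => h (basic_act w (h' e))).
Proof.
move=> [sE cq] ch ch' hK h'K qh.
have q_act w e : set_val (q (h (basic_act w (h' e)))) =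
    flip (parity w) (set_val (q e)).
  by rewrite -{2}[e]h'K !qh !flip_real_macE unfold_act flip_comm.
have cact w : continuous (fun e => h (basic_act w (h' e))).
  by apply: (cts_comp ch); apply: (cts_comp (@cts_basic_act R m K w)).
split => //.
- by move=> e; rewrite basic_act1 h'K.
- by move=> v w e; rewrite hK basic_actM.
- by move=> i e; rewrite q_act parity_cox_gen.
move=> J f JK cf qf.
pose u1 := basic_point 1%g (chamber_corner_pt R K).
have [w uw wJ] : exists2 w,
    h' (f (h u1)) = basic_point w (chamber_corner_pt R K) & parity w = J.
  apply: unfold_flip_corner;
    rewrite -[LHS](flipK J0) -flip_real_macE -qh h'K qf.
  rewrite qh flip_real_macE flip_comm flipK unfoldE.
  by congr (flip J _); apply/rowP => i; rewrite flipE parity1.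
have act1 v : h (basic_act v (h' (h u1))) = h (basic_point v (chamber_corner_pt
  R K)).
  by rewrite hK basic_actE mulg1.
exists w; split.
- apply: (@lift_unique_connected R _ _ _ q _ _ (h u1)) => //; first by case: sE.
    by move=> e; apply: set_val_inj; rewrite q_act qf wJ.
  by rewrite act1 -uw h'K.
- move=> v fv; apply: basic_corner_inj; rewrite -uw -fv act1 hK//.
Qed.

End Assembly.

Theorem proposition3p1 (R : realType) (m : nat) (K : scomplex m) :
  (exists (E : topologicalType) (q : E -> real_mac R K),
     universal_cover R q) /\
  (forall (E : topologicalType) (q : E -> real_mac R K),
     universal_cover R q ->
     exists act : coxeter K -> E -> E,
       reflection_lift_action q act /\
       exists h : basic R K -> E,
         homeomorphism h /\
         forall (w : coxeter K) (u : basic R K),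
           h (basic_act w u) = act w (h u)).
Proof.
split; first by exists (basic R K), (@unfold R m K);
  exact: universal_cover_unfold.
move=> E q uq; have [[[e0 _] _ _] _] := uq.
(* [E] may cover another component than the unfolding does; after a reflection both covers have a
   common image point. *)
have [J [u0 u0J]] := unfold_flip_onto (q e0).
have uJ : universal_cover R (fun u => flip_real_mac J (@unfold R m K u)).
  split; first exact: simply_connected_basic.
  apply: covering_map_homeomorphism; first exact: covering_unfold.
  exact: homeomorphism_flip_real_mac.
have [h [hh qh]] := universal_cover_unique
  (@real_mac_locally_path_connected R m K) uJ uq u0J.
have [ch [h' [ch' hK h'K]]] := hh.
exists (fun w e => h (basic_act w (h' e))); split.
  exact: (reflection_lift_action_transport uq ch ch' hK h'K qh).
by exists h; split => // w u; rewrite hK.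
Qed.
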